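(* Consider $\mathfrak{S}_n$ as a poset under the Bruhat order, and let $\sigma_k\le w$. The interval $[\sigma_k,w]$ is a lattice if and only if at least one of the following holds: (A) (in which case $[\sigma_k,w]$ is boolean) there is a reduced decomposition $x\,\sigma_k\,y\in R(w)$ such that $x$ and $y$ are each (possibly empty) products of distinct generators, the only generators that may appear in both $x$ and $y$ are $\sigma_{k-1}$ and $\sigma_{k+1}$, and $\sigma_k$ does not appear in $x$ or $y$; (B) there is a reduced decomposition $x\,(\sigma_k\sigma_{k-1}\sigma_{k+1}\sigma_k)\,y\in R(w)$ such that $x$ and $y$ are each (possibly empty) products of distinct generators, no generator appears in both $x$ and $y$, and no element of $\{\sigma_{k-1},\sigma_k,\sigma_{k+1}\}$ appears in either $x$ or $y$.
   Context: $\mathfrak{S}_n$ is the symmetric group with Coxeter generators $\sigma_1,\dots,\sigma_{n-1}$, where $\sigma_i$ is the transposition swapping $i$ and $i+1$; here $1\le k\le n-1$ (so (B) can occur only if $2\le k\le n-2$). A reduced decomposition of $w$ is a word $s_1\cdots s_\ell$ in these generators with product $w$ and $\ell$ minimal; $R(w)$ is the set of reduced decompositions of $w$. Bruhat order: $v\le w$ if some reduced decomposition of $v$ is a (not necessarily contiguous) subword of a reduced decomposition of $w$. $[v,w]=\{u: v\le u\le w\}$. A poset is boolean if it is isomorphic to the poset of all subsets of a finite set, ordered by inclusion. In the claim $x$ and $y$ are words in the generators. *)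

(* Defs.v *)
From mathcomp Require Import all_boot all_fingroup.

Set Implicit Arguments.
Unset Strict Implicit.
Unset Printing Implicit Defensive.

Local Open Scope group_scope.

(* 'S_n permutes {0, .., n-1}, so the Coxeter generator exchanging the i-th and
   (i+1)-st points is the transposition of the ordinals i-1 and i.  Outside the
   range 0 < i < n this is the identity; such i are never letters of words. *)
Definition sigma (n i : nat) : 'S_n :=
  match insub i.-1, insub i with
  | Some a, Some b => tperm a b
  | _, _ => 1
  end.

(* Words in the generators are sequences of indices i with 0 < i < n. *)
Definition is_word (n : nat) (s : seq nat) : bool :=
  all (fun i => 0 < i < n) s.

(* Products of permutations compose from left to right here.  The other
   convention gives the opposite group, to which w |-> w^-1 is an isomorphism
   fixing every generator, so notions defined through words do not depend on it. *)
Definition word_prod (n : nat) (s : seq nat) : 'S_n :=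
  \prod_(i <- s) sigma n i.

Definition reduced_decomposition (n : nat) (w : 'S_n) (s : seq nat) : Prop :=
  [/\ is_word n s, word_prod n s = w &
      forall t, is_word n t -> word_prod n t = w -> size s <= size t].

(* [subseq] is the not necessarily contiguous subword relation. *)
Definition bruhat (n : nat) (v w : 'S_n) : Prop :=
  exists s t, [/\ reduced_decomposition v s, reduced_decomposition w t &
                  subseq s t].

Definition bruhat_interval (n : nat) (v w u : 'S_n) : Prop :=
  bruhat v u /\ bruhat u w.

Section Posets.

Variables (T : Type) (P : T -> Prop) (r : T -> T -> Prop).

Definition is_poset : Prop :=
  [/\ forall a, P a -> r a a,
      forall a b, P a -> P b -> r a b -> r b a -> a = b &
      forall a b c, P a -> P b -> P c -> r a b -> r b c -> r a c].

Definition is_join (a b j : T) : Prop :=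
  [/\ P j, r a j, r b j & forall c, P c -> r a c -> r b c -> r j c].

Definition is_meet (a b m : T) : Prop :=
  [/\ P m, r m a, r m b & forall c, P c -> r c a -> r c b -> r c m].

Definition is_lattice : Prop :=
  is_poset /\
  forall a b, P a -> P b ->
    (exists j, is_join a b j) /\ (exists m, is_meet a b m).

Definition is_boolean : Prop :=
  exists (U : finType) (f : {set U} -> T),
    [/\ injective f,
        forall a, P a <-> exists A, f A = a &
        forall A B : {set U}, A \subset B <-> r (f A) (f B)].

End Posets.

(* For k = 1 the index k.-1 = 0, and for k = n - 1 the index k.+1 = n, is not a
   letter of any word: the generators sigma_0 and sigma_n do not exist.  Hence
   [conditionB k w] implies 2 <= k <= n - 2. *)
Definition conditionA (n k : nat) (w : 'S_n) : Prop :=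
  exists x y : seq nat,
    [/\ reduced_decomposition w (x ++ [:: k] ++ y),
        uniq x /\ uniq y,
        forall i, i \in x -> i \in y -> i = k.-1 \/ i = k.+1 &
        k \notin x /\ k \notin y].

Definition conditionB (n k : nat) (w : 'S_n) : Prop :=
  exists x y : seq nat,
    [/\ reduced_decomposition w (x ++ [:: k; k.-1; k.+1; k] ++ y),
        uniq x /\ uniq y,
        forall i, i \in x -> i \notin y &
        forall i, i \in [:: k.-1; k; k.+1] -> i \notin x /\ i \notin y].

(* Main.v *)
Require Import Defs.
From mathcomp Require Import all_boot all_fingroup.
From mathcomp Require Import zify.

(* A word acts on nat by adjacent swaps, which gives a computable test for being
   reduced, the exchange condition, and from it (by the usual induction on two
   reduced decompositions, through their common braid) the subword property.

   If [s_k, w] is a lattice, then w lies above no pair c, d of elements of equal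
   length that both cover two common elements a, b >= s_k.  Applied to
   (ik, jk; ijk, jik) and (ki, kj; kij, kji) with i, j adjacent and distinct from k,
   this excludes repeated letters; a decomposition with as few letters k as possible
   then has one k, giving (A), or passes through k (k-1)(k+1) k, giving (B) once
   12132 and its mirror images (for k = 2: a = 132, b = 232, c = 2132, d = 1232) are
   excluded as well.

   Conversely, under (A) or (B) the elements of the interval correspond to the
   subwords that contain k, hence to an intersection-closed family of finite sets:
   all subsets of the other letters under (A), a power set times the face lattice of
   a square under (B).  The letters of x and y are recovered from the permutation
   u = x s_k y of {0, .., n-1}: a letter i that occurs only once occurs iff u does not preserve
   {0, .., i-1}, and k+1 (resp. k-1) occurs in x iff u does not send k below k
   (resp. sends k-1 below k). *)

Set Implicit Arguments.
Unset Strict Implicit.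
Unset Printing Implicit Defensive.

(** * Words, reducedness and the subword property *)

(* Indices are unbounded: a word acts on nat, whatever the n of the symmetric group
   it is meant for.  The junk letter 0 acts trivially. *)
Definition sw (i p : nat) : nat :=
  if p == i.-1 then i else if p == i then i.-1 else p.

Fixpoint act (s : seq nat) (p : nat) : nat :=
  if s is i :: s' then act s' (sw i p) else p.

(* [act s i.-1 < act s i] says that i is not a left descent of [s]; in particular
   a reduced word has no letter 0. *)
Fixpoint red (s : seq nat) : bool :=
  if s is i :: s' then (act s' i.-1 < act s' i) && red s' else true.

Definition adj (i j : nat) : bool := (i == j.+1) || (j == i.+1).
Definition far (i j : nat) : bool := (i.+1 < j) || (j.+1 < i).

(** Only tests whose left side contains no other test are split, so the position reached under one
    letter is settled before the next letter is looked at. *)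
Ltac swsplit :=
  repeat match goal with
  | |- context [if ?a == ?b then _ else _] =>
      lazymatch a with
      | context [if _ then _ else _] => fail
      | _ => case: (a =P b) => ?; try (exfalso; lia)
      end
  end.

Ltac swcase := rewrite /= /sw; swsplit; lia.

Lemma swK i : involutive (sw i).
Proof. by move=> p; swcase. Qed.

Lemma act_cat s t p : act (s ++ t) p = act t (act s p).
Proof. by elim: s p => //= i s IH p. Qed.

Lemma actK s : cancel (act s) (act (rev s)).
Proof. by elim: s => //= i s IH p; rewrite rev_cons -cats1 act_cat IH /= swK. Qed.

Lemma actVK s : cancel (act (rev s)) (act s).
Proof. by move=> p; rewrite -{1}(revK s) actK. Qed.

Lemma act_inj s : injective (act s).
Proof. exact: can_inj (actK s). Qed.

Lemma eq_act_cat s s' t t' :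
  act s =1 act s' -> act t =1 act t' -> act (s ++ t) =1 act (s' ++ t').
Proof. by move=> es et p; rewrite !act_cat es et. Qed.

Lemma eq_act_catI x s s' : act (x ++ s) =1 act (x ++ s') -> act s =1 act s'.
Proof. by move=> e p; have := e (act (rev x) p); rewrite !act_cat actVK. Qed.

Lemma eq_act_catIr y s s' : act (s ++ y) =1 act (s' ++ y) -> act s =1 act s'.
Proof. by move=> e p; apply: (@act_inj y); rewrite -!act_cat. Qed.

Lemma eq_act_rev s s' : act s =1 act s' -> act (rev s) =1 act (rev s').
Proof. by move=> e p; apply: (@act_inj s); rewrite actVK e actVK. Qed.

(** Conjugation by [p] turns the transposition of [a.-1] and [a] into that of their images, here
    again a generator. *)
Lemma act_transport a j p : 0 < a -> 0 < j -> act p a.-1 = j.-1 -> act p a = j ->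
  act (a :: p) =1 act (p ++ [:: j]).
Proof.
move=> a0 j0 e1 e2 z; rewrite act_cat /= {1}/sw.
case: (z =P a.-1) => [->|n1]; first by rewrite e1 e2; swcase.
case: (z =P a) => [->|n2]; first by rewrite e1 e2; swcase.
have m1 : act p z <> j.-1 by rewrite -e1 => /act_inj.
have m2 : act p z <> j by rewrite -e2 => /act_inj.
by swcase.
Qed.

(* Follow the pair x < y through the letters of t: it gets inverted by a letter
   j that meets it in the positions j.-1 and j. *)
Lemma inversion_letter t x y : x < y -> act t y < act t x ->
  exists p j q, [/\ t = p ++ j :: q, act p x = j.-1, act p y = j & 0 < j].
Proof.
elim: t x y => [|j t IH] x y xy /= tyx; first by lia.
case: (ltnP (sw j x) (sw j y)) => h.
  by case: (IH _ _ h tyx) => p [j' [q [-> e1 e2 j0]]]; exists (j :: p), j', q.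
exists [::], j, t.
have [-> ->] : x = j.-1 /\ y = j by move: h; swcase.
by split=> //; move: xy tyx h; swcase.
Qed.

(** The letter of [t] that inverts the pair [a.-1], [a] is carried to the front by [act_transport]
    and becomes [a] there. *)
Lemma exchange a t : act t a < act t a.-1 ->
  exists p j q, t = p ++ j :: q /\ act t =1 act (a :: p ++ q).
Proof.
move=> h; have a0 : 0 < a by case: a h => //=; rewrite ltnn.
have [||p [j [q [-> e1 e2 j0]]]] := @inversion_letter t a.-1 a => //; first by lia.
exists p, j, q; split=> // z; rewrite -[j :: q]cat1s catA act_cat.
by rewrite -(act_transport a0 j0 e1 e2) /= act_cat.
Qed.

(** The first letter [a] is also a left descent of the other word, which by exchange equals [a]
    followed by that word less one letter; the induction compares what follows [a]. *)
Lemma red_min t t' : red t -> act t =1 act t' -> size t <= size t'.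
Proof.
elim: t t' => //= a t IH t' /andP[h rt] e.
have a0 : 0 < a by case: a h e => //=; rewrite ltnn.
have h' : act t' a < act t' a.-1.
  by rewrite -!e; have [-> ->] : sw a a = a.-1 /\ sw a a.-1 = a by split; swcase.
have [p [j [q [et e']]]] := exchange h'.
have : size t <= size (p ++ q).
  by apply: IH => // z; have := e (sw a z); rewrite e' /= !swK.
by rewrite et !size_cat /=; lia.
Qed.

Lemma deletion_step t : ~~ red t ->
  exists s, [/\ subseq s t, size s < size t & act s =1 act t].
Proof.
elim: t => //= a t IH; rewrite negb_and.
case: (boolP (red t)) => [_|/IH[s [st sz e]] _]; last first.
  by exists (a :: s); rewrite /= eqxx; split=> // p /=.
rewrite orbF -leqNgt leq_eqVlt => /orP[/eqP/act_inj e|/exchange].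
  (* Equality occurs only for the junk letter 0, which acts trivially and is dropped. *)
  have a0 : a = 0 by lia.
  by exists t; split=> //; [apply: subseq_cons | move=> p /=; congr act; rewrite a0; swcase].
move=> [p [j [q [-> e]]]]; exists (p ++ q); split.
- by apply: subseq_trans (subseq_cons _ _); apply: cat_subseq => //; apply: subseq_cons.
- by rewrite !size_cat /=; lia.
- by move=> z /=; rewrite e /= swK.
Qed.

Lemma deletion t : exists s, [/\ subseq s t, red s & act s =1 act t].
Proof.
have [m] := ubnP (size t); elim: m t => // m IH t tm.
case: (boolP (red t)) => [rt|/deletion_step[s [st sz e]]]; first by exists t; split.
have [|s' [ss rs e']] := IH s; first exact: leq_trans sz tm.
by exists s'; split=> //; [apply: subseq_trans ss st | move=> p; rewrite e'].
Qed.

Lemma subseq_size_eq (T : eqType) (s t : seq T) : subseq s t -> size t <= size s -> s = t.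
Proof.
move=> st h; apply/eqP; have [h1 <-] := size_subseq_leqif st.
by rewrite eqn_leq h1.
Qed.

Lemma red_shortest t t' : red t -> act t =1 act t' -> size t' <= size t -> red t'.
Proof.
move=> rt e sz; have [s [st rs e']] := deletion t'.
have h : size t <= size s by apply: red_min => // p; rewrite e'.
by rewrite -(subseq_size_eq st) //; apply: leq_trans sz h.
Qed.

Lemma red_size t t' : red t -> red t' -> act t =1 act t' -> size t = size t'.
Proof. by move=> r r' e; apply/eqP; rewrite eqn_leq !red_min. Qed.

Lemma red_catr p q : red (p ++ q) -> red q.
Proof. by elim: p => //= a p IH /andP[_ /IH]. Qed.

Lemma red_catl p q : red (p ++ q) -> red p.
Proof.
move=> r; have [s [sp rs e]] := deletion p.
have := red_min r (eq_act_cat (fun z => esym (e z)) (frefl (act q))).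
by rewrite !size_cat leq_add2r => /(subseq_size_eq sp) <-.
Qed.

Lemma red_infix p s q : red (p ++ s ++ q) -> red s.
Proof. by move/red_catr/red_catl. Qed.

Lemma red_gt0 s i : red s -> i \in s -> 0 < i.
Proof.
elim: s => //= a s IH /andP[h rs]; rewrite inE => /orP[/eqP->|]; last exact: IH.
by case: a h => //=; rewrite ltnn.
Qed.

Lemma act_far a b : far a b -> act [:: a; b] =1 act [:: b; a].
Proof. by rewrite /far => h p; swcase. Qed.

Lemma act_braid a b : adj a b -> 0 < a -> 0 < b -> act [:: a; b; a] =1 act [:: b; a; b].
Proof. by case/orP=> /eqP -> a0 b0 p; swcase. Qed.

Lemma act_adj a b : adj a b -> 0 < a -> 0 < b -> ~ act [:: a; b] =1 act [:: b; a].
Proof.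
case/orP=> /eqP -> a0 b0 e.
  by have := e b.-1; swcase.
by have := e a.-1; swcase.
Qed.

Lemma act1_inj a b : 0 < a -> act [:: a] =1 act [:: b] -> a = b.
Proof.
move=> a0 e; have := e a; have := e a.-1.
by swcase.
Qed.

Lemma act_sq b u : act [:: b, b & u] =1 act u.
Proof. by move=> p /=; rewrite swK. Qed.

Lemma red_sq b u : red [:: b, b & u] = false.
Proof. by apply/negP => r; have /= := red_min r (act_sq b u); lia. Qed.

(** The Bruhat order on words. Asking neither word nor the subword to be reduced makes it compatible
    with concatenation; [deletion] restores reducedness when it matters. *)
Definition sub (s t : seq nat) : Prop := exists2 s', subseq s' t & act s' =1 act s.

Lemma sub_ext s s' t : act s =1 act s' -> sub s t -> sub s' t.
Proof. by move=> e [r rt er]; exists r => // p; rewrite er. Qed.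

Lemma sub_subseq s t : subseq s t -> sub s t.
Proof. by exists s. Qed.

Lemma sub_cat s t s' t' : sub s t -> sub s' t' -> sub (s ++ s') (t ++ t').
Proof.
move=> [r rt er] [r' rt' er']; exists (r ++ r'); first exact: cat_subseq.
exact: eq_act_cat.
Qed.

Lemma subseq_catP (T : eqType) (s t1 t2 : seq T) : subseq s (t1 ++ t2) ->
  exists s1 s2, [/\ s = s1 ++ s2, subseq s1 t1 & subseq s2 t2].
Proof.
case/subseqP=> m sm ->.
exists (mask (take (size t1) m) t1), (mask (drop (size t1) m) t2).
rewrite -mask_cat ?cat_take_drop ?mask_subseq //.
by rewrite size_takel // sm size_cat leq_addr.
Qed.

Lemma sub_catl s t t' u : (forall r, subseq r t -> sub r t') -> sub s (t ++ u) -> sub s (t' ++ u).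
Proof.
move=> h [r /subseq_catP[r1 [r2 [-> s1 s2]]] e].
by apply: (sub_ext e); apply: sub_cat; [apply: h | apply: sub_subseq].
Qed.

Lemma sub_catr s t t' u : (forall r, subseq r t -> sub r t') -> sub s (u ++ t) -> sub s (u ++ t').
Proof.
move=> h [r /subseq_catP[r1 [r2 [-> s1 s2]]] e].
by apply: (sub_ext e); apply: sub_cat; [apply: sub_subseq | apply: h].
Qed.

Lemma sub_far a b r : far a b -> subseq r [:: a; b] -> sub r [:: b; a].
Proof.
move=> h /subseqP[m]; case: m => [|m1 [|m2 [|? ?]]] //= _ ->.
case: m1; case: m2 => /=.
- by apply: sub_ext (sub_subseq (subseq_refl _)) => p; rewrite (act_far h).
- by apply: sub_subseq; rewrite sub1seq !inE eqxx orbT.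
- by apply: sub_subseq; rewrite sub1seq !inE eqxx.
- exact: sub_subseq (sub0seq _).
Qed.

Lemma sub_braid a b r : adj a b -> 0 < a -> 0 < b ->
  subseq r [:: a; b; a] -> sub r [:: b; a; b].
Proof.
move=> h a0 b0 /subseqP[m]; case: m => [|m1 [|m2 [|m3 [|? ?]]]] //= _ ->.
have S1 : sub [:: a] [:: b; a; b] by apply: sub_subseq; rewrite sub1seq !inE eqxx orbT.
have E : sub [::] [:: b; a; b] by exact: sub_subseq (sub0seq _).
have hab : (a == b) = false by move: h; rewrite /adj; lia.
case: m1; case: m2; case: m3 => //=.
- by apply: sub_ext (sub_subseq (subseq_refl _)) => p; rewrite (act_braid h).
- by apply: sub_subseq; rewrite /= hab !eqxx.
(* The subword [a a] represents the identity. *)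
- by apply: sub_ext E => p; rewrite /= swK.
- by apply: sub_subseq; rewrite /= !eqxx.
- by apply: sub_subseq; rewrite /= !eqxx.
Qed.

(** The element has two distinct left descents [a] and [b]. Exchanging for [a] in [b :: t'] gives a
    word beginning with [a b]; if [a] and [b] do not commute, exchanging once more for [b] gives
    [b a b], that is, [a b a]. *)
Lemma braid_prefix a b t t' : red (a :: t) -> red (b :: t') ->
  act (a :: t) =1 act (b :: t') -> a != b ->
  (far a b /\ exists u, act (a :: t) =1 act ([:: a; b] ++ u) /\ size (a :: t) = size ([:: a; b] ++ u)) \/
  (adj a b /\ exists u, act (a :: t) =1 act ([:: a; b; a] ++ u) /\ size (a :: t) = size ([:: a; b; a] ++ u)).
Proof.
move=> ra rb e nab.
have a0 : 0 < a by apply: (red_gt0 ra); rewrite inE eqxx.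
have b0 : 0 < b by apply: (red_gt0 rb); rewrite inE eqxx.
have desc c s s' : red (c :: s) -> act (c :: s) =1 act s' -> act s' c < act s' c.-1.
  move=> /= /andP[h _] es; rewrite -!es.
  have c0 : 0 < c by case: c h {es} => //=; rewrite ltnn.
  by have [-> ->] : sw c c = c.-1 /\ sw c c.-1 = c by split; swcase.
have sz := red_size ra rb e.
have [[|b1 p] [j [q [et eb]]]] := exchange (desc _ _ _ ra e).
  case: et => ? et; subst j q.
  suff /(act1_inj a0) ab : act [:: a] =1 act [:: b] by rewrite ab eqxx in nab.
  by apply: (@eq_act_catIr t') => p; rewrite -eb.
case: et => ? et; subst b1.
have [nf|adj_ab] : far a b \/ adj a b by move: nab; rewrite /far /adj; lia.
  left; split=> //; exists (p ++ q); split; first by move=> z; rewrite e eb.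
  by rewrite sz et /= !size_cat /=; lia.
right; split=> //.
have rc : red [:: b, a & p ++ q] \/ True by right.
have e2 : act (a :: t) =1 act [:: a, b & p ++ q] by move=> z; rewrite e eb.
have r2 : red [:: a, b & p ++ q].
  by apply: red_shortest ra e2 _; rewrite sz et /= !size_cat /=; lia.
have e3 : act (b :: t') =1 act [:: a, b & p ++ q] by move=> z; rewrite -e e2.
(* The exchanged letter lies beyond the first two: giving up [a] would leave a reduced word
   beginning with [b b], and giving up [b] would make [a] and [b] commute. *)
have [[|a1 [|b2 p2]] [j2 [q2 [et2 eb2]]]] := exchange (desc _ _ _ rb e3).
- case: et2 => ? et2; subst j2 q2.
  suff : red [:: b, b & p ++ q] by rewrite red_sq.
  by apply: red_shortest r2 eb2 _.
- case: et2 => ? ? et2; subst a1 j2 q2.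
  suff : act [:: a; b] =1 act [:: b; a] by move/(act_adj adj_ab a0 b0).
  by apply: (@eq_act_catIr (p ++ q)).
- case: et2 => ? ? et2; subst a1 b2.
  exists (p2 ++ q2); split.
    move=> z; rewrite e2 eb2 act_cat (act_braid adj_ab a0 b0).
    by rewrite -act_cat.
  by rewrite (red_size ra r2 e2) /= et2 !size_cat /=; lia.
Qed.

(** Induction on the length. Words with the same first letter are compared through their tails;
    otherwise [braid_prefix] supplies intermediate words. *)
Lemma subword_property s t t' : red t -> red t' -> act t =1 act t' -> sub s t -> sub s t'.
Proof.
have [m] := ubnP (size t); elim: m s t t' => // m IH s [|a t] [|b t'] //=.
  by move=> _ rt rt' e; have := red_size (t := [::]) isT (t' := b :: t') rt' e.
  by move=> _ rt rt' e; have := red_size (t := a :: t) rt (t' := [::]) isT e.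
move=> szm ra rb e.
have szt := red_size (t := a :: t) (t' := b :: t') ra rb e.
have red_tl c v : red (c :: v) -> red v by case/andP.
have IHc c v v' r : size v < m -> red (c :: v) -> red (c :: v') ->
    act (c :: v) =1 act (c :: v') -> sub r (c :: v) -> sub r (c :: v').
  move=> sv rv rv' ev; apply: (@sub_catr r v v' [:: c]) => r' /sub_subseq.
  by apply: IH => //; [exact: red_tl rv | exact: red_tl rv' | exact: (@eq_act_catI [:: c])].
have [eab|nab] := eqVneq a b.
  by subst b; apply: IHc.
(* The chain is [a :: t], [a :: u1], [b :: u2], [b :: t']: the outer pairs share their first letter,
   and the middle pair differs by a single commutation or braid at the front. *)
have bridge u1 u2 :
    (forall r, subseq r (a :: u1) -> sub r (b :: u2)) ->
    act (a :: u1) =1 act (b :: u2) -> act (a :: t) =1 act (a :: u1) ->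
    size u1 = size t -> size u2 = size t -> sub s (a :: t) -> sub s (b :: t').
  move=> h e12 et s1 s2.
  have r1 : red (a :: u1) by apply: red_shortest et _ => //=; rewrite s1.
  have r2 : red (b :: u2) by apply: red_shortest r1 e12 _ => /=; rewrite s1 s2.
  move/(IHc a t u1 s szm ra r1 et) => [r /h hr er].
  apply: (IHc b u2 t' s _ r2 rb) (sub_ext er hr); first by rewrite s2.
  by move=> z; have := e z; have := et z; have := e12 z => /= <- <- <-.
have [[f [u [eu su]]]|[f [u [eu su]]]] := braid_prefix ra rb e nab.
- apply: (bridge (b :: u) (a :: u)) => //.
  + by move=> r /sub_subseq; apply: (@sub_catl r [:: a; b] [:: b; a]) => ?; apply: sub_far.
  + by apply: (@eq_act_cat [:: a; b] [:: b; a] u u) => //; apply: act_far.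
  + by move: su => /=; lia.
  + by move: su => /=; lia.
have a0 : 0 < a by apply: (@red_gt0 (a :: t)); rewrite // inE eqxx.
have b0 : 0 < b by apply: (@red_gt0 (b :: t')); rewrite // inE eqxx.
apply: (bridge [:: b, a & u] [:: a, b & u]) => //.
- by move=> r /sub_subseq; apply: (@sub_catl r [:: a; b; a] [:: b; a; b]) => ?; apply: sub_braid.
- by apply: (@eq_act_cat [:: a; b; a] [:: b; a; b] u u) => //; apply: act_braid.
- by move: su => /=; lia.
- by move: su => /=; lia.
Qed.

Lemma sub_trans s t u : red t -> sub s t -> sub t u -> sub s u.
Proof.
move=> rt st [r ru e]; have [r1 [rr1 rd er]] := deletion r.
have [r2 r2r er2] := subword_property rt rd (fun p => esym (etrans (er p) (e p))) st.
by exists r2 => //; apply: subseq_trans r2r (subseq_trans rr1 ru).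
Qed.

(** * Words and the Bruhat order of the symmetric group *)

(** Only the letter [i] moves a point across the cut between [i.-1] and [i]. *)
Lemma act_lt_notin i s p : i \notin s -> (act s p < i) = (p < i).
Proof.
elim: s p => //= a s IH p; rewrite inE negb_or => /andP[ai /IH ->].
have [->|a0] := posnP a; first by congr (_ < _); swcase.
by apply/idP/idP; swcase.
Qed.

(** The point that [s] brings to [i.-1] is carried across the cut by the letter [i], and [s'] cannot
    bring it back. *)
Lemma act_once i s s' : 0 < i -> i \notin s -> i \notin s' ->
  exists2 p, p < i & i <= act (s ++ i :: s') p.
Proof.
move=> i0 h h'; exists (act (rev s) i.-1).
  by rewrite act_lt_notin ?mem_rev //; lia.
rewrite act_cat actVK /= leqNgt act_lt_notin //.
by swcase.
Qed.

Lemma mem_once i s s' t : 0 < i -> i \notin s -> i \notin s' ->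
  act t =1 act (s ++ i :: s') -> i \in t.
Proof.
move=> i0 h h' e; apply/negPn/negP => it.
have [p pi] := act_once i0 h h'.
by rewrite -e leqNgt act_lt_notin // pi.
Qed.

Lemma sub1_mem i t : 0 < i -> sub [:: i] t -> i \in t.
Proof.
move=> i0 [r rt e]; apply: (mem_subseq rt).
by apply: (@mem_once i [::] [::]).
Qed.

Lemma red_mem i t t' : red t -> red t' -> act t =1 act t' -> i \in t -> i \in t'.
Proof.
move=> r r' e it; apply: sub1_mem; first exact: red_gt0 it.
by apply: (subword_property r r' e); apply: sub_subseq; rewrite sub1seq.
Qed.

Lemma is_word_sub n s t : {subset s <= t} -> is_word n t -> is_word n s.
Proof. by move=> st /allP h; apply/allP => i /st; apply: h. Qed.

Lemma sigmaE n i (a : 'I_n) : 0 < i < n -> val (sigma n i a) = sw i a.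
Proof.
move=> /andP[i0 ilt]; have i1 : i.-1 < n by lia.
rewrite /sigma !insubT /= permE /= /sw -!val_eqE /=.
by case: eqP => // _; case: eqP.
Qed.

Lemma word_prodE n s (a : 'I_n) : is_word n s -> val (word_prod n s a) = act s a.
Proof.
rewrite /word_prod; elim: s a => [|i s IH] a /=; first by rewrite big_nil permE.
by case/andP=> hi hs; rewrite big_cons permM IH // sigmaE.
Qed.

Lemma act_ge n s p : is_word n s -> n <= p -> act s p = p.
Proof.
elim: s p => //= i s IH p /andP[hi hs] np.
have -> : sw i p = p by swcase.
exact: IH.
Qed.

Lemma word_prod_eq n s t : is_word n s -> is_word n t ->
  word_prod n s = word_prod n t <-> act s =1 act t.
Proof.
move=> hs ht; split=> [e p|e].
  have [pn|np] := ltnP p n; last by rewrite !(@act_ge n).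
  by rewrite -[p]/(val (Ordinal pn)) -!(word_prodE _ (n := n)) // e.
by apply/permP=> a; apply: val_inj; rewrite !word_prodE.
Qed.

(** [deletion] only drops letters, so it never leaves the words in the generators of ['S_n]. *)
Lemma reduced_decompositionP n (w : 'S_n) s :
  reduced_decomposition w s <-> [/\ is_word n s, word_prod n s = w & red s].
Proof.
split=> [] [hs e h]; split=> //; last first.
  by move=> t ht et; apply: red_min h _; apply/(word_prod_eq hs ht); rewrite e.
have [r [rs rr er]] := deletion s.
have hr : is_word n r by apply: is_word_sub hs; apply: mem_subseq.
rewrite -(subseq_size_eq rs) //; apply: h => //.
by rewrite -e; apply/word_prod_eq.
Qed.

(** By the subword property, the reduced decomposition of the larger element can be fixed in
    advance. *)
Lemma bruhatP n (v : 'S_n) t : is_word n t -> red t ->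
  bruhat v (word_prod n t) <->
  exists s, [/\ subseq s t, red s & word_prod n s = v].
Proof.
move=> wt rt; split=> [[s [t' [/reduced_decompositionP[ws <- rs] /reduced_decompositionP[wt' e rt'] st]]]|[s [st rs <-]]].
  have et : act t' =1 act t by apply/(word_prod_eq wt' wt).
  have [r0 r0t er0] := subword_property rt' rt et (sub_subseq st).
  have [r [rr0 rr er]] := deletion r0.
  have rt0 := subseq_trans rr0 r0t.
  exists r; split=> //; apply/word_prod_eq => //.
    by apply: is_word_sub wt; apply: mem_subseq.
  by move=> p; rewrite er er0.
exists s, t; split=> //; apply/reduced_decompositionP; split=> //.
by apply: is_word_sub wt; apply: mem_subseq.
Qed.

Lemma bruhat_sub n s t : is_word n s -> is_word n t -> red t ->
  bruhat (word_prod n s) (word_prod n t) <-> sub s t.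
Proof.
move=> ws wt rt; split=> [/(bruhatP _ wt rt)[r [rs rr /word_prod_eq e]]|[r rt' e]].
  by exists r => //; apply: e => //; apply: is_word_sub wt; apply: mem_subseq.
apply/(bruhatP _ wt rt); have [r1 [rr1 rr er]] := deletion r.
have h := subseq_trans rr1 rt'.
exists r1; split=> //; apply/word_prod_eq => //.
  by apply: is_word_sub wt; apply: mem_subseq.
by move=> p; rewrite er e.
Qed.

Lemma word_prod1 n k : word_prod n [:: k] = sigma n k.
Proof. by rewrite /word_prod big_seq1. Qed.

(** * Obstructions to being a lattice *)

(** Two elements of equal length above [s_k], and two elements one longer, each above both. It is
    boolean so that concrete instances are settled by evaluation; distinctness of the elements is
    stated apart, in [crossing_free]. *)
Definition crossing (k : nat) (a b c d : seq nat) : bool :=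
  [&& [&& red a, red b, red c & red d],
      [&& k \in a, k \in b, size a == size b, size c == (size a).+1 & size d == size c],
      subseq a c, subseq a d, subseq b c & subseq b d].

Definition crossing_free (k : nat) (t : seq nat) : Prop :=
  forall a b c d, crossing k a b c d ->
    ~ act a =1 act b -> ~ act c =1 act d -> sub c t -> sub d t -> False.

Lemma sub_mem s t : red s -> sub s t -> {subset s <= t}.
Proof.
move=> rs [r rt e] i; have [r1 [rr1 rr er]] := deletion r.
move=> /(red_mem rs rr (fun p => esym (etrans (er p) (e p)))) h.
by apply: (mem_subseq rt); apply: (mem_subseq rr1).
Qed.

(* A join of a and b is longer than a and at most as long as c and d, hence equal to
   both. *)
Lemma lattice_crossing_free n k t : is_word n t -> red t -> k \in t ->
  is_lattice (bruhat_interval (sigma n k) (word_prod n t)) (@bruhat n) -> crossing_free k t.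
Proof.
move=> wt rt kt [_ lat] a b c d /and3P[/and4P[ra rb rc rd] /and5P[ka kb /eqP sab /eqP sc /eqP sd] /and4P[ac ad bc bd]] nab ncd ct dt.
have wc : is_word n c by apply: is_word_sub wt; apply: sub_mem.
have wd : is_word n d by apply: is_word_sub wt; apply: sub_mem.
have wa : is_word n a by apply: is_word_sub wc; apply: mem_subseq.
have wb : is_word n b by apply: is_word_sub wc; apply: mem_subseq.
have wk : is_word n [:: k] by apply: is_word_sub wt => i; rewrite inE => /eqP->.
have inP s s' : is_word n s -> is_word n s' -> red s -> red s' -> k \in s -> subseq s s' ->
    sub s' t -> bruhat_interval (sigma n k) (word_prod n t) (word_prod n s).
  move=> ws ws' rs rs' ks ss' st; split.
    by rewrite -word_prod1; apply/bruhat_sub => //; apply: sub_subseq; rewrite sub1seq.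
  by apply/bruhat_sub => //; apply: sub_trans st => //; apply: sub_subseq.
have Pa := inP _ _ wa wc ra rc ka ac ct.
have Pb := inP _ _ wb wc rb rc kb bc ct.
have Pc := inP _ _ wc wc rc rc (mem_subseq ac ka) (subseq_refl _) ct.
have Pd := inP _ _ wd wd rd rd (mem_subseq ad ka) (subseq_refl _) dt.
have [[J [[_ Jt] aJ bJ Jmin]] _] := lat _ _ Pa Pb.
have := Jmin _ Pc; have := Jmin _ Pd.
have bru s s' : is_word n s -> is_word n s' -> red s' -> subseq s s' ->
    bruhat (word_prod n s) (word_prod n s').
  by move=> ws ws' rs' ss'; apply/bruhat_sub => //; apply: sub_subseq.
move=> /(_ (bru _ _ wa wd rd ad) (bru _ _ wb wd rd bd)) Jd.
move=> /(_ (bru _ _ wa wc rc ac) (bru _ _ wb wc rc bc)) Jc.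
have [s [st rs eJ]] := (bruhatP J wt rt).1 Jt; subst J.
have ws : is_word n s by apply: is_word_sub wt; apply: mem_subseq.
have eq_top r : is_word n r -> red r -> size r = size c ->
   bruhat (word_prod n s) (word_prod n r) -> size s = size c -> act s =1 act r.
  move=> wr rr sr /(bruhat_sub ws wr rr)[s1 s1r e1] ss.
  have h : size s <= size s1 by apply: red_min => // p; rewrite e1.
  by rewrite -(subseq_size_eq s1r) // sr -ss.
have eq_bot r : is_word n r -> red r ->
   bruhat (word_prod n r) (word_prod n s) -> size s <= size r -> act s =1 act r.
  move=> wr rr /(bruhat_sub wr ws rs)[s1 s1s e1] ss.
  have h : size r <= size s1 by apply: red_min => // p; rewrite e1.
  by rewrite -(subseq_size_eq s1s) //; apply: leq_trans ss h.
have sz : size s <= size c.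
  have [s1 s1c e1] := (bruhat_sub ws wc rc).1 Jc.
  apply: leq_trans (size_subseq s1c).
  by apply: red_min => // p; rewrite e1.
have [ss|ss] := eqVneq (size s) (size c).
  by apply: ncd => p; rewrite -(eq_top c) // -(eq_top d).
have {}sz : size s <= size a by rewrite -ltnS -sc ltn_neqAle ss.
by apply: nab => p; rewrite -(eq_bot a) // -(eq_bot b) // -sab.
Qed.

(** The letters after [a] do not cross the cut at [a], so [a.-1] stays below it and [a] stays above
    it. *)
Lemma uniq_red s : uniq s -> 0 \notin s -> red s.
Proof.
elim: s => //= a s IH /andP[as_ us]; rewrite inE negb_or => /andP[a0 s0].
rewrite IH // andbT; apply: (@leq_trans a).
  by rewrite act_lt_notin //; lia.
by rewrite leqNgt act_lt_notin // ltnn.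
Qed.

(** Carries computations in ['S_4] to any position. The letter 0 is excluded because it acts
    trivially while its shift [o] need not. *)
Lemma act_shift o s p : 0 \notin s -> act (map (addn o) s) (o + p) = o + act s p.
Proof.
elim: s p => //= a s IH p; rewrite inE negb_or => /andP[a0 s0].
rewrite -IH //; congr act.
by rewrite /sw; swsplit; lia.
Qed.

Lemma red_notin0 s : red s -> 0 \notin s.
Proof. by move=> rs; apply/negP => /(red_gt0 rs). Qed.

Lemma red_shift o s : red s -> red (map (addn o) s).
Proof.
elim: s => //= a s IH /andP[h rs]; rewrite IH // andbT.
have a0 : 0 < a by case: a h => //=; rewrite ltnn.
have -> : (o + a).-1 = o + a.-1 by lia.
by rewrite !act_shift ?red_notin0 // ltn_add2l.
Qed.

(** A computable proof of inequality: words in the letters 1, 2, 3 move only the points 0 to 3. *)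
Definition differ (s t : seq nat) : bool := has (fun p => act s p != act t p) (iota 0 4).

Lemma differ_shift o s t : red s -> red t -> differ s t ->
  ~ act (map (addn o) s) =1 act (map (addn o) t).
Proof.
move=> rs rt /hasP[p _ /eqP h] e; apply: h; apply: (@addnI o).
by rewrite -!act_shift ?red_notin0.
Qed.

Lemma crossing_shift o k a b c d : crossing k a b c d ->
  crossing (o + k) (map (addn o) a) (map (addn o) b) (map (addn o) c) (map (addn o) d).
Proof.
have inj := @addnI o.
case/and3P=> /and4P[ra rb rc rd] /and5P[ka kb sab sc sd] /and4P[ac ad bc bd].
by rewrite /crossing !red_shift // !(mem_map inj) !size_map ka kb sab sc sd !map_subseq.
Qed.

Lemma crossing_free_shift o k t a b c d : crossing k a b c d -> differ a b -> differ c d ->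
  crossing_free (o + k) t -> sub (map (addn o) c) t -> sub (map (addn o) d) t -> False.
Proof.
move=> h dab dcd cf; apply: cf (crossing_shift o h) _ _;
by case/and3P: h => /and4P[ra rb rc rd] _ _; apply: differ_shift.
Qed.

Section CrossingFree.

Variables (k : nat) (t : seq nat).
Hypotheses (k_gt0 : 0 < k) (cf : crossing_free k t).

(** Meant for words containing [i j i] before a letter [k], which have both [i j k] and [j i k] as
    subwords. *)
Lemma crossing_free_adjl i j : adj i j -> 0 < i -> 0 < j -> i != k -> j != k ->
  sub [:: i; j; k] t -> sub [:: j; i; k] t -> False.
Proof.
move=> h i0 j0 ik jk; have ij : i != j by move: h; rewrite /adj; lia.
have [oi oj ok] : [/\ 0 != i, 0 != j & 0 != k] by split; lia.
apply: (cf (a := [:: i; k]) (b := [:: j; k])).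
- have ki : k != i by rewrite eq_sym. have kj : k != j by rewrite eq_sym.
  have ji : j != i by rewrite eq_sym.
  rewrite /crossing; rewrite !uniq_red /= ?inE ?negb_or ?ij ?ik ?jk ?ji ?oi ?oj ?ok //.
  by rewrite !eqxx !orbT ?(negbTE ij) ?(negbTE ji) ?(negbTE ki) ?(negbTE kj) /= ?eqxx.
- by move/(@eq_act_catIr [:: k] [:: i] [:: j])/(act1_inj i0)/eqP; apply/negP.
- by move/(@eq_act_catIr [:: k] [:: i; j] [:: j; i]); apply: act_adj.
Qed.

Lemma crossing_free_adjr i j : adj i j -> 0 < i -> 0 < j -> i != k -> j != k ->
  sub [:: k; i; j] t -> sub [:: k; j; i] t -> False.
Proof.
move=> h i0 j0 ik jk; have ij : i != j by move: h; rewrite /adj; lia.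
have [oi oj ok] : [/\ 0 != i, 0 != j & 0 != k] by split; lia.
apply: (cf (a := [:: k; i]) (b := [:: k; j])).
- have ki : k != i by rewrite eq_sym. have kj : k != j by rewrite eq_sym.
  have ji : j != i by rewrite eq_sym.
  rewrite /crossing; rewrite !uniq_red /= ?inE ?negb_or ?ij ?ki ?kj ?ji ?oi ?oj ?ok //.
  by rewrite !eqxx ?(negbTE ij) ?(negbTE ji) /= ?eqxx.
- by move/(@eq_act_catI [:: k] [:: i] [:: j])/(act1_inj i0)/eqP; apply/negP.
- by move/(@eq_act_catI [:: k] [:: i; j] [:: j; i]); apply: act_adj.
Qed.

Lemma crossing_free5 s : 1 < k ->
  s \in [:: [:: k.-1; k; k.-1; k.+1; k]; [:: k.+1; k; k.+1; k.-1; k];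
            [:: k; k.-1; k.+1; k; k.+1]; [:: k; k.+1; k.-1; k; k.-1]] ->
  sub s t -> False.
Proof.
move=> k1; have [o ko] : exists o, k = o + 2 by exists (k - 2); lia.
have -> : k.-1 = o + 1 by lia.
have -> : k.+1 = o + 3 by lia.
have cfo : crossing_free (o + 2) t by rewrite -ko.
have H a b c d u : [&& crossing 2 a b c d, differ a b, differ c d, red u, subseq c u & subseq d u] ->
    sub (map (addn o) u) t -> False.
  case/and5P=> h dab dcd ru /andP[cu du] ut.
  have st v : subseq v u -> sub (map (addn o) v) t.
    by move=> vu; apply: sub_trans ut; [exact: red_shift | apply/sub_subseq/map_subseq].
  exact: (crossing_free_shift h dab dcd cfo (st _ cu) (st _ du)).
rewrite ko !inE => /or4P[] /eqP->.
- by apply: (@H [:: 1; 3; 2] [:: 2; 3; 2] [:: 2; 1; 3; 2] [:: 1; 2; 3; 2] [:: 1; 2; 1; 3; 2]).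
- by apply: (@H [:: 3; 1; 2] [:: 2; 1; 2] [:: 2; 3; 1; 2] [:: 3; 2; 1; 2] [:: 3; 2; 3; 1; 2]).
- by apply: (@H [:: 2; 1; 3] [:: 2; 1; 2] [:: 2; 1; 3; 2] [:: 2; 1; 2; 3] [:: 2; 1; 3; 2; 3]).
- by apply: (@H [:: 2; 3; 1] [:: 2; 3; 2] [:: 2; 3; 1; 2] [:: 2; 3; 2; 1] [:: 2; 3; 1; 2; 1]).
Qed.

(* The forbidden words of [crossing_free5] are, up to the shift by [k - 2], the images of
   [1 2 1 3 2] under reversal and under the exchange of 1 and 3; each contains its own crossing for
   the middle letter 2. *)
End CrossingFree.

(** * Shape of the reduced words of crossing-free elements *)

Lemma first_occ (T : eqType) (i : T) s : i \in s -> exists p q, s = p ++ i :: q /\ i \notin p.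
Proof.
elim: s => //= a s IH; have [->|ia] := eqVneq i a; first by exists [::], s.
rewrite inE (negbTE ia) => /IH[p [q [-> ip]]]; exists (a :: p), q.
by rewrite inE (negbTE ia).
Qed.

Lemma last_occ (T : eqType) (i : T) s : i \in s -> exists p q, s = p ++ i :: q /\ i \notin q.
Proof.
rewrite -mem_rev => /first_occ[p [q [e ip]]]; exists (rev q), (rev p).
by rewrite mem_rev -(revK s) e rev_cat rev_cons cat_rcons.
Qed.

Lemma not_uniq_split (T : eqType) (s : seq T) : ~~ uniq s ->
  exists p i z q, s = p ++ i :: z ++ i :: q /\ i \notin z.
Proof.
elim: s => //= a s IH; rewrite negb_and negbK.
case: (boolP (a \in s)) => [/first_occ[z [q [-> az]]] _|_ /IH[p [i [z [q [-> iz]]]]]].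
  by exists [::], a, z, q.
by exists (a :: p), i, z, q.
Qed.

Lemma act_comm s t p : {in s & t, forall a b, far a b} -> act t (act s p) = act s (act t p).
Proof.
have one a u q : {in u, forall b, far a b} -> act u (sw a q) = sw a (act u q).
  elim: u q => //= b u IH q h; have fab : far a b by apply: h; rewrite inE eqxx.
  rewrite -IH; last by move=> c cu; apply: h; rewrite inE cu orbT.
  by congr act; have := act_far fab q.
elim: s p => //= a s IH p h; rewrite IH; last by move=> x y xs; apply: h; rewrite inE xs orbT.
by congr act; apply: one => b bt; apply: h => //; rewrite inE eqxx.
Qed.

Lemma act_comm1 a t p : {in t, forall b, far a b} -> act t (sw a p) = sw a (act t p).
Proof. by move=> h; apply: (@act_comm [:: a]) => x y; rewrite inE => /eqP->; apply: h. Qed.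

Lemma act_filter (P : pred nat) s p :
  {in s &, forall a b, P a -> ~~ P b -> far a b} ->
  act s p = act (filter (predC P) s) (act (filter P s) p).
Proof.
elim: s p => //= a s IH p h; rewrite IH; last first.
  by move=> x y xs ys; apply: h; rewrite inE ?xs ?ys orbT.
case: (boolP (P a)) => //= Pa; rewrite act_comm1 // => b.
rewrite mem_filter => /andP[Pb bs].
have : far b a by apply: h; rewrite ?inE ?bs ?eqxx ?orbT.
by rewrite /far orbC.
Qed.

(** Otherwise [i] would commute with everything between its two occurrences, and these would
    cancel. *)
Lemma red_gap p i z q : red (p ++ i :: z ++ i :: q) -> i \notin z ->
  exists2 j, j \in z & adj i j.
Proof.
move=> r iz; case: (boolP (has (adj i) z)) => [/hasP[j jz h]|/hasPn h]; first by exists j.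
have fz : {in z, forall b, far i b}.
  move=> b bz; have := h b bz; have : i != b by apply: contraNneq iz => ->.
  by rewrite /adj /far; lia.
have : act (p ++ i :: z ++ i :: q) =1 act (p ++ z ++ q).
  by move=> x; rewrite !act_cat /= act_cat /= -act_comm1 // swK.
by move/(red_min r); rewrite !size_cat /= !size_cat /=; lia.
Qed.

Lemma subseq_skip (T : eqType) (s p t : seq T) : subseq s t -> subseq s (p ++ t).
Proof. by move=> h; apply: subseq_trans h (suffix_subseq _ _). Qed.

Lemma subseq_cons_same (T : eqType) (a : T) s t : subseq s t -> subseq (a :: s) (a :: t).
Proof. by move=> h /=; rewrite eqxx. Qed.

Lemma subseq_cons_skip (T : eqType) (a : T) s t : subseq s t -> subseq s (a :: t).
Proof. by move=> h; apply: subseq_trans h (subseq_cons _ _). Qed.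

Ltac solve_subseq :=
  rewrite ?(=^~ catA, cat_cons) ?cat0s;
  do ![exact: sub0seq | apply: subseq_cons_same | apply: subseq_cons_skip | apply: subseq_skip].

Lemma sub_swap2 a b s t : far a b -> sub [:: a, b & s] t -> sub [:: b, a & s] t.
Proof.
move=> h; apply: sub_ext => p; have := @act_far a b h p.
by move=> /= ->.
Qed.

Lemma sub_swap3 a b c t : far b c -> sub [:: a; b; c] t -> sub [:: a; c; b] t.
Proof. by move=> h; apply: sub_ext => p /=; have /= -> := @act_far b c h (sw a p). Qed.

Lemma adj_far i j : adj i j -> far i j = false.
Proof. by rewrite /adj /far; lia. Qed.

Lemma farC i j : far i j = far j i.
Proof. by rewrite /far orbC. Qed.

Lemma adj_neq i j : adj i j -> i != j.
Proof. by rewrite /adj; lia. Qed.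

Lemma far_of_neq k i : 0 < k -> i != k -> i != k.-1 -> i != k.+1 -> far i k.
Proof. by rewrite /far; lia. Qed.

Lemma adj_or k j : adj k j -> j = k.-1 \/ j = k.+1.
Proof. by rewrite /adj; lia. Qed.

Lemma far_pred_succ k : 0 < k -> far k.-1 k.+1.
Proof. by rewrite /far; lia. Qed.

Section Forms.

Variables (k : nat) (t : seq nat).
Hypotheses (rt : red t) (kt : k \in t) (cf : crossing_free k t).

Let k_gt0 : 0 < k. Proof. exact: red_gt0 rt kt. Qed.

Let crossl i j : adj i j -> i \in t -> j \in t -> i != k -> j != k ->
  sub [:: i; j; k] t -> sub [:: j; i; k] t -> False.
Proof. by move=> h /(red_gt0 rt) i0 /(red_gt0 rt) j0; apply: (crossing_free_adjl k_gt0 cf). Qed.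

Let crossr i j : adj i j -> i \in t -> j \in t -> i != k -> j != k ->
  sub [:: k; i; j] t -> sub [:: k; j; i] t -> False.
Proof. by move=> h /(red_gt0 rt) i0 /(red_gt0 rt) j0; apply: (crossing_free_adjr k_gt0 cf). Qed.

(** Between two consecutive occurrences of [i], [red_gap] finds a neighbour [j], and [i j i]
    followed by [k] is ruled out by [crossl]. *)
Lemma uniq_prefix x r : t = x ++ k :: r -> k \notin x -> uniq x.
Proof.
move=> et kx; apply/negPn/negP => /not_uniq_split[p [i [z [q [ex iz]]]]]; subst x.
have [j jz ij] : exists2 j, j \in z & adj i j.
  by apply: (@red_gap p i z (q ++ k :: r)) => //; rewrite -!catA /= -catA in et; rewrite -et.
move: kx; case/path.splitPr: jz et iz => z1 z2 et iz kx.
have [ik jk] : i != k /\ j != k.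
  by split; apply: contraNneq kx => <-; rewrite !mem_cat !inE ?mem_cat ?inE eqxx ?orbT.
apply: (@crossl i j) => //.
1,2: by rewrite et !mem_cat !inE ?mem_cat ?inE eqxx ?orbT.
1,2: by apply: sub_subseq; rewrite et; solve_subseq.
Qed.

Lemma uniq_suffix l y : t = l ++ k :: y -> k \notin y -> uniq y.
Proof.
move=> et ky; apply/negPn/negP => /not_uniq_split[p [i [z [q [ex iz]]]]]; subst y.
have [j jz ij] : exists2 j, j \in z & adj i j.
  by apply: (@red_gap (l ++ k :: p) i z q) => //; rewrite -catA -et.
move: ky; case/path.splitPr: jz et iz => z1 z2 et iz ky.
have [ik jk] : i != k /\ j != k.
  by split; apply: contraNneq ky => <-; rewrite !mem_cat !inE ?mem_cat ?inE eqxx ?orbT.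
apply: (@crossr i j) => //.
1,2: by rewrite et !(mem_cat, inE) eqxx ?orbT.
1,2: by apply: sub_subseq; rewrite et; solve_subseq.
Qed.

(** If [i] were not a neighbour of [k], it would commute with [k], and [red_gap] would give a
    neighbour [j] of [i] between its occurrences in [x] and [y]. Whether [j] lies in [x], [m] or
    [y], moving [i] past [k] in a subword produces a forbidden pair. The middle [m] will be [k]
    alone or [k (k-1) (k+1) k]. *)
Lemma shared_letter x m y i : t = x ++ m ++ y -> k \notin x -> k \notin y -> k \in m ->
  {in m, forall j, j != k -> subseq [:: k; j; k] m} ->
  i \notin m -> i \in x -> i \in y -> i = k.-1 \/ i = k.+1.
Proof.
move=> et kx ky km hm im ix iy.
have [->|i1] := eqVneq i k.-1; first by left.
have [->|i2] := eqVneq i k.+1; [by right | exfalso].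
have ik : i != k by apply: contraNneq im => ->.
have fik : far i k by apply: far_of_neq.
have fki : far k i by rewrite farC.
have [x1 [x2 [ex ix2]]] := last_occ ix; have [y1 [y2 [ey iy1]]] := first_occ iy; subst x y.
have it : i \in t by rewrite et mem_cat ix.
have [j jz ij] : exists2 j, j \in (x2 ++ m ++ y1) & adj i j.
  apply: (@red_gap x1 i (x2 ++ m ++ y1) y2); last by rewrite !mem_cat !negb_or ix2 im.
  by have := rt; rewrite et !(=^~ catA, cat_cons).
have jk : j != k by apply: contraTneq fik => <-; rewrite (adj_far ij).
have jt : j \in t.
  by rewrite et; move: jz; rewrite !(mem_cat, inE) => /or3P[] ->; rewrite ?orbT.
have sm : subseq [:: k] m by rewrite sub1seq.
have smx s u v : subseq s m -> subseq (u ++ s ++ v) (u ++ m ++ v).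
  by move=> h; do 2![apply: cat_subseq => //].
move: jz; rewrite !mem_cat => /or3P[jx|jm|jy].
- case/path.splitPr: jx et kx ix2 => z1 z2 et kx ix2.
  apply: (@crossl i j) => //.
    apply: sub_subseq; apply: subseq_trans (_ : subseq _ ((x1 ++ i :: z1 ++ j :: z2) ++ [:: k] ++ y1 ++ i :: y2)) _.
      by solve_subseq.
    by rewrite et; apply: smx.
  apply: (@sub_swap3 j k i) => //.
  apply: sub_subseq; apply: subseq_trans (_ : subseq _ ((x1 ++ i :: z1 ++ j :: z2) ++ [:: k] ++ y1 ++ i :: y2)) _.
    by solve_subseq.
  by rewrite et; apply: smx.
- have skjk := hm _ jm jk.
  have S : subseq ((x1 ++ i :: x2) ++ [:: k; j; k] ++ (y1 ++ i :: y2)) t by rewrite et; apply: smx.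
  apply: (@crossr i j) => //.
    apply: (@sub_swap2 i k) => //.
    by apply: sub_subseq; apply: subseq_trans S; solve_subseq.
  by apply: sub_subseq; apply: subseq_trans S; solve_subseq.
- case/path.splitPr: jy et ky iy1 => z1 z2 et ky iy1.
  have S : subseq ((x1 ++ i :: x2) ++ [:: k] ++ ((z1 ++ j :: z2) ++ i :: y2)) t by rewrite et; apply: smx.
  apply: (@crossr i j) => //.
    apply: (@sub_swap2 i k) => //.
    by apply: sub_subseq; apply: subseq_trans S; solve_subseq.
  by apply: sub_subseq; apply: subseq_trans S; solve_subseq.
Qed.

(** A second [l] would enclose a neighbour [j] of [l], different from [k] as [k] is not in [z]; then
    [l j l] after the first [k] is ruled out by [crossr]. *)
Lemma middle_once l x z y : t = x ++ k :: z ++ k :: y -> k \notin z -> adj k l -> l \in z ->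
  exists z1 z2, [/\ z = z1 ++ l :: z2, l \notin z1 & l \notin z2].
Proof.
move=> et kz kl lz; have [z1 [z2 [ez lz1]]] := first_occ lz; exists z1, z2; split=> //.
apply/negP => /first_occ[z3 [z4 [ez2 lz3]]]; subst z2 z.
have [j jz lj] : exists2 j, j \in z3 & adj l j.
  apply: (@red_gap (x ++ k :: z1) l z3 (z4 ++ k :: y)) => //.
  by have := rt; rewrite et !(=^~ catA, cat_cons).
have jk : j != k.
  by apply: contraNneq kz => <-; rewrite !(mem_cat, inE) jz !orbT.
have lk : l != k by rewrite eq_sym adj_neq.
case/path.splitPr: jz et lz3 => w1 w2 et lz3.
apply: (@crossr l j) => //.
1,2: by rewrite et !(mem_cat, inE) eqxx ?orbT.
1,2: by apply: sub_subseq; rewrite et; solve_subseq.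
Qed.

(** First [crossing_free5] keeps [k.-1] and [k.+1] out of [x] and [y], in two of the four cases
    after these commuting letters are exchanged in the middle. A further [k] would then have no
    neighbour between it and the nearest [k] of the middle, against [red_gap]. *)
Lemma middle_form x y : 1 < k -> t = x ++ [:: k; k.-1; k.+1; k] ++ y ->
  [/\ uniq x, uniq y, forall i, i \in x -> i \notin y &
      forall i, i \in [:: k.-1; k; k.+1] -> i \notin x /\ i \notin y].
Proof.
move=> k1 et.
pose et' := x ++ [:: k; k.+1; k.-1; k] ++ y.
have fk := far_pred_succ k_gt0.
have e' : act t =1 act et'.
  by move=> p; rewrite et !act_cat /=; have /= -> := @act_far _ _ fk (sw k (act x p)).
have r' : red et' by apply: red_shortest rt e' _; rewrite et !size_cat.
have c5 s := @crossing_free5 k t k_gt0 cf s k1.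
have nlx : k.-1 \notin x.
  apply/negP; move=> ix; case/path.splitPr: ix et e' => z1 z2 et e'.
  apply: (c5 [:: k.-1; k; k.-1; k.+1; k]); first by rewrite !inE eqxx.
  by apply: sub_subseq; rewrite et; solve_subseq.
have nrx : k.+1 \notin x.
  apply/negP; move=> ix; apply: (c5 [:: k.+1; k; k.+1; k.-1; k]); first by rewrite !inE eqxx ?orbT.
  apply: (subword_property r' rt (fun p => esym (e' p))).
  rewrite /et'; case/path.splitPr: ix => z1 z2.
  by apply: sub_subseq; solve_subseq.
have nry : k.+1 \notin y.
  apply/negP; move=> iy; case/path.splitPr: iy et e' => z1 z2 et e'.
  apply: (c5 [:: k; k.-1; k.+1; k; k.+1]); first by rewrite !inE eqxx ?orbT.
  by apply: sub_subseq; rewrite et; solve_subseq.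
have nly : k.-1 \notin y.
  apply/negP; move=> iy; apply: (c5 [:: k; k.+1; k.-1; k; k.-1]); first by rewrite !inE eqxx ?orbT.
  apply: (subword_property r' rt (fun p => esym (e' p))).
  rewrite /et'; case/path.splitPr: iy => z1 z2.
  by apply: sub_subseq; solve_subseq.
have kx : k \notin x.
  apply/negP => /last_occ[p [q [ex kq]]].
  have [j jq /adj_or[]?] : exists2 j, j \in q & adj k j.
    - apply: (@red_gap p k q ([:: k.-1; k.+1; k] ++ y)) => //.
      by move: rt; rewrite et ex -!catA.
    - by subst j; rewrite ex mem_cat inE jq !orbT in nlx.
    - by subst j; rewrite ex mem_cat inE jq !orbT in nrx.
have ky : k \notin y.
  apply/negP => /first_occ[p [q [ey kp]]].
  have [j jp /adj_or[]?] : exists2 j, j \in p & adj k j.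
    - apply: (@red_gap (x ++ [:: k; k.-1; k.+1]) k p q) => //.
      by move: rt; rewrite et ey -!catA.
    - by subst j; rewrite ey mem_cat jp in nly.
    - by subst j; rewrite ey mem_cat jp in nry.
split.
- exact: (@uniq_prefix x ([:: k.-1; k.+1; k] ++ y)).
- by apply: (@uniq_suffix (x ++ [:: k; k.-1; k.+1]) y); rewrite // et -catA.
- move=> i ix; apply/negP => iy.
  have ik : i != k by apply: contraNneq kx => <-.
  have i1 : i != k.-1 by apply: contraNneq nlx => <-.
  have i2 : i != k.+1 by apply: contraNneq nrx => <-.
  case: (@shared_letter x [:: k; k.-1; k.+1; k] y i) => //.
  + by rewrite !inE eqxx.
  + move=> j; rewrite !inE => /or4P[]/eqP-> //; rewrite ?eqxx // => _.
      by solve_subseq.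
    by solve_subseq.
  + by rewrite !inE !negb_or ik i1 i2.
  + by move/eqP: i1.
  + by move/eqP: i2.
- by move=> i; rewrite !inE => /or3P[]/eqP->.
Qed.

End Forms.

(** For reduced [t], equal action and equal size make [x ++ c ++ y] a reduced word of the same
    element. *)
Definition form (c t : seq nat) (P : seq nat -> seq nat -> Prop) : Prop :=
  exists x y, [/\ act (x ++ c ++ y) =1 act t, size (x ++ c ++ y) = size t & P x y].

Lemma form_ext c t t' P : act t =1 act t' -> size t = size t' -> form c t P -> form c t' P.
Proof.
move=> e es [x [y [h1 h2 h3]]]; exists x, y; split=> //; last by rewrite h2.
by move=> p; rewrite h1.
Qed.

Definition formA (k : nat) (t : seq nat) : Prop :=
  form [:: k] t (fun x y => [/\ uniq x /\ uniq y,
    forall i, i \in x -> i \in y -> i = k.-1 \/ i = k.+1 & k \notin x /\ k \notin y]).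

Definition formB (k : nat) (t : seq nat) : Prop :=
  form [:: k; k.-1; k.+1; k] t (fun x y => [/\ uniq x /\ uniq y,
    forall i, i \in x -> i \notin y &
    forall i, i \in [:: k.-1; k; k.+1] -> i \notin x /\ i \notin y]).

Lemma crossing_free_ext k t t' : red t -> red t' -> act t =1 act t' ->
  crossing_free k t -> crossing_free k t'.
Proof.
move=> r r' e cf a b c d h nab ncd ct dt; apply: (cf a b c d) => //.
  exact: (subword_property r' r (fun p => esym (e p))).
exact: (subword_property r' r (fun p => esym (e p))).
Qed.

Lemma commute_off k (z : seq nat) : k \notin z -> k.-1 \notin z -> k.+1 \notin z -> 0 < k ->
  {in z, forall b, far k b}.
Proof.
move=> kz lz rz k0 b bz; rewrite farC; apply: far_of_neq => //.
- by apply: contraNneq kz => <-.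
- by apply: contraNneq lz => <-.
- by apply: contraNneq rz => <-.
Qed.

(* Letters smaller than k.-1 commute with k.+1 and k, letters greater than k.+1 with
   k.-1 and k: one kind leaves [z2] to the left, the other to the right. *)
Lemma move_out k l l' (x z1 z2 z3 y : seq nat) : 0 < k ->
  (l = k.-1 /\ l' = k.+1) \/ (l = k.+1 /\ l' = k.-1) ->
  {in z1, forall b, far k b} -> {in z2, forall b, far k b} -> {in z3, forall b, far k b} ->
  exists x' y', act (x ++ k :: z1 ++ l :: z2 ++ l' :: z3 ++ k :: y) =1
    act (x' ++ [:: k; k.-1; k.+1; k] ++ y') /\
    size (x' ++ [:: k; k.-1; k.+1; k] ++ y') = size (x ++ k :: z1 ++ l :: z2 ++ l' :: z3 ++ k :: y).
Proof.
move=> k0 ll h1 h2 h3; pose P b := (l < k) == (k < b).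
pose f1 := filter P z2; pose f2 := filter (predC P) z2.
have ef p : act z2 p = act f2 (act f1 p).
  by apply: act_filter => a b /h2 ha /h2 hb; rewrite /P; move: ha hb; case: ll => [] [-> _]; rewrite /far; move: k0; clear; lia.
have f1k : {in f1, forall b, far k b} by move=> b; rewrite mem_filter => /andP[_ /h2].
have f2k : {in f2, forall b, far k b} by move=> b; rewrite mem_filter => /andP[_ /h2].
have f1l : {in f1, forall b, far l b}.
  move=> b; rewrite mem_filter => /andP[+ /h2]; rewrite /P.
  by case: ll => [] [-> _]; rewrite /far; move: k0; clear; lia.
have f2l : {in f2, forall b, far l' b}.
  move=> b; rewrite mem_filter /= => /andP[+ /h2]; rewrite /P.
  by case: ll => [] [-> ->]; rewrite /far; move: k0; clear; lia.
have swll p : sw l' (sw l p) = sw k.+1 (sw k.-1 p).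
  case: ll => [] [-> ->] //.
  by have := act_far (far_pred_succ k0) p.
exists (x ++ z1 ++ f1), (f2 ++ z3 ++ y); split.
  move=> p; rewrite ?(act_cat, (=^~ catA), cat_cons) /= ?act_cat /= ?act_cat /= ?act_cat /=.
  rewrite ef (act_comm1 _ h1) -(act_comm1 _ h3).
  rewrite (act_comm1 _ f1l) (act_comm1 _ f1k).
  by rewrite -(act_comm1 _ f2l) -(act_comm1 _ f2k) swll.
have : size z2 = size f1 + size f2 by rewrite !size_filter count_predC.
do ?rewrite size_cat /=; move: (size f1) (size f2) (size z2) => a b c; clear; lia.
Qed.

Lemma crossing_free_form k t : red t -> k \in t -> crossing_free k t -> formA k t \/ formB k t.
Proof.
have [m] := ubnP (count_mem k t); elim: m t => // m IH t cm rt kt cf.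
have k0 := red_gt0 rt kt.
have [x [r [et kx]]] := first_occ kt.
case: (boolP (k \in r)) => [kr|kr]; last first.
  left; exists x, r; rewrite et; split=> //.
  have et1 : t = x ++ [:: k] ++ r by [].
  split=> //; first by split; [exact: uniq_prefix rt kt cf _ _ et kx | exact: uniq_suffix rt kt cf _ _ et kr].
  move=> i ix iy; apply: (shared_letter rt kt cf et1 kx kr) => //.
  - by rewrite inE.
  - by move=> j; rewrite inE => ->.
  - by rewrite inE; apply: contraNneq kx => <-.
have [z [y [er kz]]] := first_occ kr; subst r.
have once l := @middle_once k t rt kt cf l x z y et kz.
have single l l' : (l = k.-1 /\ l' = k.+1) \/ (l = k.+1 /\ l' = k.-1) ->
    l \in z -> l' \notin z -> formA k t \/ formB k t.
  move=> ll lz lz'.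
  have akl : adj k l by move: k0; case: ll => [] [-> _]; rewrite /adj; clear; lia.
  have [z1 [z2 [ez lz1 lz2]]] := once _ akl lz.
  have off (w : seq nat) : {subset w <= z} -> l \notin w -> {in w, forall b, far k b}.
    move=> wz lw; apply: commute_off => //.
    - by apply: contra kz => /wz.
    - by case: ll => [] [e e']; rewrite -?e -?e' //; apply: contra lz' => /wz.
    - by case: ll => [] [e e']; rewrite -?e -?e' //; apply: contra lz' => /wz.
  have h1 : {in z1, forall b, far k b} by apply: off => // b bz; rewrite ez mem_cat bz.
  have h2 : {in z2, forall b, far k b} by apply: off => // b bz; rewrite ez mem_cat inE bz !orbT.
  pose t2 := x ++ z1 ++ [:: l; k; l] ++ z2 ++ y.
  have l0 : 0 < l by apply: (red_gt0 rt); rewrite et !(mem_cat, inE) lz !orbT.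
  have e2 : act t =1 act t2.
    move=> p; rewrite et ez /t2 ?(act_cat, (=^~ catA), cat_cons) /= ?act_cat /= ?act_cat /=.
    rewrite (act_comm1 _ h1) -(act_comm1 _ h2).
    by have /= -> := act_braid akl k0 l0 (act z1 (act x p)).
  have s2 : size t = size t2 by rewrite et ez /t2; do ?rewrite size_cat /=; clear; lia.
  have r2 : red t2 by apply: red_shortest rt e2 _; rewrite s2.
  have k2 : k \in t2 by exact: red_mem rt r2 e2 kt.
  have lk : (l == k) = false by apply: negbTE; rewrite eq_sym adj_neq.
  have c2 : count_mem k t2 < m.
    rewrite -ltnS; apply: leq_trans cm; rewrite ltnS et ez /t2; do ?rewrite count_cat /=.
    by rewrite eqxx lk; clear; lia.
  case: (IH t2 c2 r2 k2 (crossing_free_ext rt r2 e2 cf)) => h; [left|right].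
  - exact: form_ext h.
  - exact: form_ext h.
have count1 l : adj k l -> l \in z -> count_mem l z = 1.
  move=> kl lz; have [z1 [z2 [-> /count_memPn c1 /count_memPn c2]]] := once _ kl lz.
  by rewrite count_cat /= c1 c2 eqxx.
have both l l' z1 w z3 : (l = k.-1 /\ l' = k.+1) \/ (l = k.+1 /\ l' = k.-1) ->
    z = z1 ++ l :: w ++ l' :: z3 -> formA k t \/ formB k t.
  move=> ll ez; right.
  have [akl akl'] : adj k l /\ adj k l' by move: k0; case: ll => [] [-> ->]; rewrite /adj; clear; lia.
  have c0 v : count_mem l v = 0 -> l \notin v by move/count_memPn.
  have c0' v : count_mem l' v = 0 -> l' \notin v by move/count_memPn.
  have : count_mem l z = 1 by apply: count1; rewrite // ez !(mem_cat, inE) eqxx !orbT.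
  have : count_mem l' z = 1 by apply: count1; rewrite // ez !(mem_cat, inE) eqxx !orbT.
  rewrite ez; do ?rewrite count_cat /=; rewrite !eqxx => n' n.
  have {n} [/c0 lz1 /c0 lw /c0 lz3] : [/\ count_mem l z1 = 0, count_mem l w = 0 & count_mem l z3 = 0].
    by move: (count_mem l z1) (count_mem l w) (count_mem l z3) n; clear => a b c /= n; split; lia.
  have {n'} [/c0' lz1' /c0' lw' /c0' lz3'] : [/\ count_mem l' z1 = 0, count_mem l' w = 0 & count_mem l' z3 = 0].
    by move: (count_mem l' z1) (count_mem l' w) (count_mem l' z3) n'; clear => a b c /= n; split; lia.
  have off (v : seq nat) : {subset v <= z} -> l \notin v -> l' \notin v -> {in v, forall b, far k b}.
    move=> vz lv lv'; apply: commute_off => //.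
    - by apply: contra kz => /vz.
    - by case: ll => [] [e e']; rewrite -?e -?e'.
    - by case: ll => [] [e e']; rewrite -?e -?e'.
  have h1 : {in z1, forall b, far k b} by apply: off => // b bz; rewrite ez mem_cat bz.
  have h2 : {in w, forall b, far k b}.
    by apply: off => // b bz; rewrite ez !(mem_cat, inE) bz !orbT.
  have h3 : {in z3, forall b, far k b}.
    by apply: off => // b bz; rewrite ez !(mem_cat, inE) bz !orbT.
  have [x' [y' [e' s']]] := move_out x y k0 ll h1 h2 h3.
  have et' : t = x ++ k :: z1 ++ l :: w ++ l' :: z3 ++ k :: y.
    by rewrite et ez ?((=^~ catA), cat_cons).
  rewrite -et' in e' s'.
  have r' : red (x' ++ [:: k; k.-1; k.+1; k] ++ y') by apply: red_shortest rt e' _; rewrite s'.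
  have k1 : 1 < k.
    have : 0 < k.-1 by apply: (red_gt0 r'); rewrite !(mem_cat, inE) eqxx !orbT.
    by clear; lia.
  have kt' : k \in x' ++ [:: k; k.-1; k.+1; k] ++ y' by rewrite !(mem_cat, inE) eqxx !orbT.
  have [ux uy dxy off3] := middle_form r' kt' (crossing_free_ext rt r' e' cf) k1 erefl.
  by exists x', y'; split.
case: (boolP (k.-1 \in z)) => [pz|pz]; case: (boolP (k.+1 \in z)) => [sz|sz].
- have ap : adj k k.-1 by rewrite /adj; move: k0; clear; lia.
  have [z1 [z2 [ez pz1 pz2]]] := once _ ap pz.
  move: sz; rewrite ez mem_cat inE => /or3P[sz1|/eqP|sz2].
  + case/path.splitPr: sz1 ez => w1 w2 ez.
    by apply: (both k.+1 k.-1 w1 w2 z2); [right | rewrite ez -catA].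
  + by clear; lia.
  + case/path.splitPr: sz2 ez => w1 w2 ez.
    by apply: (both k.-1 k.+1 z1 w1 w2) => //; left.
- by apply: (single k.-1 k.+1) => //; left.
- by apply: (single k.+1 k.-1) => //; right.
- exfalso; have [j jz /adj_or[]?] := @red_gap x k z y (etrans (congr1 red (esym et)) rt) kz.
  + by subst j; rewrite jz in pz.
  + by subst j; rewrite jz in sz.
Qed.

(** * Intervals coded by an intersection-closed family of sets *)

Lemma lattice_of_family (T : Type) (P : T -> Prop) (r : T -> T -> Prop)
    (U : finType) (F : pred {set U}) (f : {set U} -> T) :
  F [set: U] -> (forall A B, F A -> F B -> F (A :&: B)) ->
  (forall a, P a <-> exists2 A, F A & f A = a) ->
  (forall A B, F A -> F B -> A \subset B <-> r (f A) (f B)) ->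
  is_lattice P r.
Proof.
move=> FT FI Pf rf; split.
  split=> [a /Pf[A FA <-]|a b /Pf[A FA <-] /Pf[B FB <-]|a b c /Pf[A FA <-] /Pf[B FB <-] /Pf[C FC <-]].
  - exact/rf.
  - by move=> /(rf _ _ FA FB) AB /(rf _ _ FB FA) BA; congr f; apply/eqP; rewrite eqEsubset AB.
  - by move=> /(rf _ _ FA FB) AB /(rf _ _ FB FC) BC; apply/rf => //; apply: subset_trans BC.
move=> a b /Pf[A FA <-] /Pf[B FB <-]; split.
  pose J := \bigcap_(C | F C && (A :|: B \subset C)) C.
  have FJ : F J by apply: (big_ind (fun C => is_true (F C))) => // C /andP[].
  have ABJ : A :|: B \subset J by apply/bigcapsP => C /andP[].
  move: (ABJ); rewrite subUset => /andP[AJ BJ].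
  exists (f J); split; [by apply/Pf; exists J | exact/rf | exact/rf |].
  move=> c /Pf[C FC <-] /(rf _ _ FA FC) AC /(rf _ _ FB FC) BC; apply/rf => //.
  by apply: bigcap_inf; rewrite FC subUset AC.
have FAB := FI _ _ FA FB.
exists (f (A :&: B)); split.
- by apply/Pf; exists (A :&: B).
- by apply/rf; rewrite ?subsetIl.
- by apply/rf; rewrite ?subsetIr.
- move=> c /Pf[C FC <-] /(rf _ _ FC FA) CA /(rf _ _ FC FB) CB; apply/rf => //.
  by rewrite subsetI CA.
Qed.

Section CodedInterval.

Variables (n k : nat) (U : finType) (F : pred {set U}) (word : {set U} -> seq nat).

Hypotheses (k_gt0 : 0 < k) (FT : F [set: U]) (wT : is_word n (word [set: U])).
Hypothesis word_mono : forall A B, F A -> F B -> A \subset B -> subseq (word A) (word B).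
Hypothesis word_sub : forall B s, F B -> subseq s (word B) -> red s -> k \in s ->
  exists A, [/\ F A, A \subset B & s = word A].
Hypothesis word_inj : forall A B, F A -> F B -> act (word A) =1 act (word B) -> A = B.
Hypothesis word_k : forall A s, F A -> act s =1 act (word A) -> k \in s.

(* A reduced subword representing the same permutation as [word A] is itself the
   word of some A' included in A, and A' = A by injectivity. *)
Lemma coded_red A : F A -> red (word A).
Proof.
move=> FA; have [s [ss rs es]] := deletion (word A).
have [B [FB BA eB]] := word_sub FA ss rs (word_k FA es).
by rewrite -(word_inj FB FA) // -eB.
Qed.

Lemma coded_word A : F A -> is_word n (word A).
Proof.
by move=> FA; apply: is_word_sub wT; apply/mem_subseq/word_mono; rewrite ?subsetT.
Qed.

Lemma coded_interval a :
  bruhat_interval (sigma n k) (word_prod n (word [set: U])) a <->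
  exists2 A, F A & word_prod n (word A) = a.
Proof.
split=> [[ka /(bruhatP _ wT (coded_red FT))[s [st rs ea]]]|[A FA <-]].
  subst a.
  have ws : is_word n s by apply: is_word_sub wT; apply: mem_subseq.
  have wk : is_word n [:: k].
    have := coded_word FT; have := word_k FT (frefl _) => kT /allP/(_ k kT) kn.
    by rewrite /is_word /= kn.
  have ks : k \in s.
    by apply: sub1_mem => //; apply/(bruhat_sub wk ws rs); rewrite word_prod1.
  by have [A [FA _ ->]] := word_sub FT st rs ks; exists A.
have kA : k \in word A by exact: (word_k FA).
have wA := coded_word FA.
split; last first.
  by apply/(bruhat_sub wA wT (coded_red FT)); apply/sub_subseq/word_mono; rewrite ?subsetT.
have wk : is_word n [:: k] by apply: is_word_sub wA => i; rewrite inE => /eqP->.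
rewrite -word_prod1; apply/(bruhat_sub wk wA (coded_red FA)).
by apply: sub_subseq; rewrite sub1seq.
Qed.

Lemma coded_order A B : F A -> F B ->
  A \subset B <-> bruhat (word_prod n (word A)) (word_prod n (word B)).
Proof.
move=> FA FB; have wA := coded_word FA; have wB := coded_word FB.
split=> [AB|/(bruhat_sub wA wB (coded_red FB))[r rB er]].
  by apply/(bruhat_sub wA wB (coded_red FB)); apply/sub_subseq/word_mono.
have [s [sr rs es]] := deletion r.
have esA : act s =1 act (word A) by move=> p; rewrite es.
have [C [FC CB eC]] := word_sub FB (subseq_trans sr rB) rs (word_k FA esA).
by rewrite -(word_inj FC FA) // -eC.
Qed.

Lemma coded_lattice : (forall A B, F A -> F B -> F (A :&: B)) ->
  is_lattice (bruhat_interval (sigma n k) (word_prod n (word [set: U]))) (@bruhat n).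
Proof.
move=> FI; apply: (lattice_of_family (f := fun A => word_prod n (word A)) FT FI).
  exact: coded_interval.
exact: coded_order.
Qed.

Lemma coded_boolean : (forall A, F A) ->
  is_boolean (bruhat_interval (sigma n k) (word_prod n (word [set: U]))) (@bruhat n).
Proof.
move=> Fall; exists U, (fun A => word_prod n (word A)); split.
- move=> A B /(word_prod_eq (coded_word (Fall A)) (coded_word (Fall B))).
  exact: word_inj.
- by move=> a; split=> [/coded_interval[A _ <-]|[A <-]]; [exists A | apply/coded_interval; exists A].
- by move=> A B; apply: coded_order.
Qed.

End CodedInterval.

Section Factored.

Variables (k : nat) (x y : seq nat) (V : finType) (G : pred {set V}) (mid : {set V} -> seq nat).

Definition factors : finType := (seq_sub x + seq_sub y + V)%type.

Implicit Types A B : {set factors}.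

Definition pickl A : seq nat :=
  [seq i <- x | oapp (fun u : seq_sub x => inl (inl u) \in A) false (insub i)].
Definition pickr A : seq nat :=
  [seq i <- y | oapp (fun u : seq_sub y => inl (inr u) \in A) false (insub i)].
Definition pickm A : {set V} := [set v | inr v \in A].
Definition factored A : seq nat := pickl A ++ mid (pickm A) ++ pickr A.

Lemma mem_pickl A (u : seq_sub x) : (val u \in pickl A) = (inl (inl u) \in A).
Proof. by rewrite mem_filter valK /= (valP u) andbT. Qed.

Lemma mem_pickr A (u : seq_sub y) : (val u \in pickr A) = (inl (inr u) \in A).
Proof. by rewrite mem_filter valK /= (valP u) andbT. Qed.

Lemma pick_subset A B :
  (A \subset B) = [&& all (mem (pickl B)) (pickl A), pickm A \subset pickm B & all (mem (pickr B)) (pickr A)].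
Proof.
apply/subsetP/and3P => [AB|[/allP hl /subsetP hm /allP hr]].
  split.
  - apply/allP => i; case: (boolP (i \in x)) => [ix|ix]; last by rewrite mem_filter (negbTE ix) andbF.
    by rewrite -[i]/(val (SeqSub ix)) inE !mem_pickl; apply: AB.
  - by apply/subsetP=> v; rewrite !inE; apply: AB.
  - apply/allP => i; case: (boolP (i \in y)) => [iy|iy]; last by rewrite mem_filter (negbTE iy) andbF.
    by rewrite -[i]/(val (SeqSub iy)) inE !mem_pickr; apply: AB.
case=> [[u|u]|v].
- by rewrite -!mem_pickl; apply: hl.
- by rewrite -!mem_pickr; apply: hr.
- by have := hm v; rewrite !inE.
Qed.

Lemma pick_eq A B : pickl A = pickl B -> pickm A = pickm B -> pickr A = pickr B -> A = B.
Proof.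
move=> el em er; apply/setP => -[[u|u]|v].
- by rewrite -!mem_pickl el.
- by rewrite -!mem_pickr er.
- by have := congr1 (fun C : {set V} => v \in C) em; rewrite !inE.
Qed.

Lemma pickT : [/\ pickl [set: factors] = x, pickr [set: factors] = y & pickm [set: factors] = setT].
Proof.
split.
- by apply/all_filterP/allP => i ix; rewrite insubT /= inE.
- by apply/all_filterP/allP => i ix; rewrite insubT /= inE.
- by apply/setP => v; rewrite !inE.
Qed.

Lemma pick_onto (s1 s2 : seq nat) (D : {set V}) : uniq x -> uniq y -> subseq s1 x -> subseq s2 y ->
  exists A, [/\ pickl A = s1, pickr A = s2 & pickm A = D].
Proof.
move=> ux uy sx sy.
exists [set u : factors | match u with
  | inl (inl a) => val a \in s1 | inl (inr b) => val b \in s2 | inr v => v \in D end].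
split; last by apply/setP => v; rewrite !inE.
  rewrite [RHS](subseq_uniqP ux sx); apply: eq_in_filter => i ix.
  by rewrite insubT /= inE.
rewrite [RHS](subseq_uniqP uy sy); apply: eq_in_filter => i iy.
by rewrite insubT /= inE.
Qed.

Lemma sub_filter (P Q : pred nat) s : {in s, forall i, P i -> Q i} -> subseq (filter P s) (filter Q s).
Proof.
move=> PQ; have -> : filter P s = filter P (filter Q s).
  by rewrite -filter_predI; apply: eq_in_filter => i /PQ /=; case: (P i) => // ->.
exact: filter_subseq.
Qed.

Lemma pickl_mono A B : A \subset B -> subseq (pickl A) (pickl B).
Proof. by move=> /subsetP AB; apply: sub_filter => i ix; rewrite insubT /=; apply: AB. Qed.

Lemma pickr_mono A B : A \subset B -> subseq (pickr A) (pickr B).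
Proof. by move=> /subsetP AB; apply: sub_filter => i ix; rewrite insubT /=; apply: AB. Qed.

Hypotheses (k_gt0 : 0 < k) (ux : uniq x) (uy : uniq y) (kx : k \notin x) (ky : k \notin y).
Hypothesis mid_mono : forall C D, G C -> G D -> C \subset D -> subseq (mid C) (mid D).
Hypothesis mid_sub : forall D s, G D -> subseq s (mid D) -> red s -> k \in s ->
  exists C, [/\ G C, C \subset D & s = mid C].
Hypothesis mid_k : forall D, G D -> exists2 p, p < k & k <= act (mid D) p.

Lemma notin_pickl A i : i \notin x -> i \notin pickl A.
Proof. by apply: contra; rewrite mem_filter => /andP[]. Qed.

Lemma notin_pickr A i : i \notin y -> i \notin pickr A.
Proof. by apply: contra; rewrite mem_filter => /andP[]. Qed.

Lemma factored_mono A B : G (pickm A) -> G (pickm B) -> A \subset B ->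
  subseq (factored A) (factored B).
Proof.
move=> GA GB AB; apply: cat_subseq; first exact: pickl_mono.
apply: cat_subseq; last exact: pickr_mono.
by apply: mid_mono => //; move: AB; rewrite pick_subset => /and3P[].
Qed.

Lemma factored_sub B s : G (pickm B) -> subseq s (factored B) -> red s -> k \in s ->
  exists A, [/\ G (pickm A), A \subset B & s = factored A].
Proof.
move=> GB /subseq_catP[s1 [s' [-> h1 /subseq_catP[s2 [s3 [-> h2 h3]]]]]] rs.
have k1 : k \notin s1 by apply: contra (notin_pickl B kx); apply: mem_subseq.
have k3 : k \notin s3 by apply: contra (notin_pickr B ky); apply: mem_subseq.
rewrite !mem_cat (negbTE k1) (negbTE k3) orbF /= => k2.
have [C [GC CB eC]] := mid_sub GB h2 (red_infix rs) k2.
have [A [e1 e3 e2]] := pick_onto C ux uy (subseq_trans h1 (filter_subseq _ _)) (subseq_trans h3 (filter_subseq _ _)).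
exists A; split; first by rewrite e2.
  by rewrite pick_subset e1 e2 e3 CB /=; apply/andP; split; apply/allP => i /=; apply: mem_subseq.
by rewrite /factored e1 e2 e3 eC.
Qed.

Lemma factored_k A s : G (pickm A) -> act s =1 act (factored A) -> k \in s.
Proof.
move=> GA e; apply/negPn/negP => ks.
have [p pk kp] := mid_k GA.
have pk' : act (rev (pickl A)) p < k by rewrite act_lt_notin // mem_rev notin_pickl.
have := act_lt_notin (act (rev (pickl A)) p) ks.
rewrite pk' e /factored !act_cat actVK act_lt_notin ?notin_pickr //.
by rewrite ltnNge kp.
Qed.

Hypothesis factored_inj : forall A B, G (pickm A) -> G (pickm B) ->
  act (factored A) =1 act (factored B) -> A = B.
Hypothesis GT : G [set: V].

Lemma factored_lattice n : is_word n (x ++ mid [set: V] ++ y) ->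
  (forall C D, G C -> G D -> G (C :&: D)) ->
  is_lattice (bruhat_interval (sigma n k) (word_prod n (x ++ mid [set: V] ++ y))) (@bruhat n).
Proof.
have [ex ey em] := pickT; have -> : x ++ mid [set: V] ++ y = factored setT by rewrite /factored ex ey em.
move=> wT GI; apply: (@coded_lattice n k factors (fun A => G (pickm A)) factored) => //.
- by rewrite em.
- exact: factored_mono.
- exact: factored_sub.
- exact: factored_k.
move=> A B GA GB /=; have e : pickm (A :&: B) = pickm A :&: pickm B by apply/setP => v; rewrite !inE.
by rewrite e; apply: GI.
Qed.

Lemma factored_boolean n : is_word n (x ++ mid [set: V] ++ y) -> (forall C, G C) ->
  is_boolean (bruhat_interval (sigma n k) (word_prod n (x ++ mid [set: V] ++ y))) (@bruhat n).
Proof.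
have [ex ey em] := pickT; have -> : x ++ mid [set: V] ++ y = factored setT by rewrite /factored ex ey em.
move=> wT Gall; apply: (@coded_boolean n k factors (fun A => G (pickm A)) factored) => //.
- exact: factored_mono.
- exact: factored_sub.
- exact: factored_k.
Qed.

End Factored.

Lemma uniq_subseq_eq (T : eqType) (s s1 s2 : seq T) :
  uniq s -> subseq s1 s -> subseq s2 s -> s1 =i s2 -> s1 = s2.
Proof.
move=> us h1 h2 e; rewrite (subseq_uniqP us h1) (subseq_uniqP us h2).
by apply: eq_filter => i /=; rewrite e.
Qed.

Lemma act_fix s i : i \notin s -> i.+1 \notin s -> act s i = i.
Proof.
move=> h h'; have := act_lt_notin i h; have := act_lt_notin i h'.
by move: (act s i); clear; lia.
Qed.

Lemma act_ge_notin i s p : i \notin s -> (i <= act s p) = (i <= p).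
Proof. by move=> h; rewrite leqNgt act_lt_notin // -leqNgt. Qed.

Lemma succ_mem_left k x y : 0 < k -> uniq x -> k \notin x -> k \notin y ->
  (k.+1 \in x) = (k <= act (x ++ k :: y) k).
Proof.
move=> k0 ux kx ky; rewrite act_cat /= act_ge_notin //.
case: (boolP (k.+1 \in x)) => [h|h]; last by rewrite act_fix //; swcase.
case/path.splitPr: h ux kx => p q; rewrite cat_uniq /= mem_cat inE !negb_or.
move=> /and3P[_ /andP[sp _] /andP[sq _]] /and3P[kp _ kq].
rewrite act_cat /= (act_fix kp sp).
have -> : sw k.+1 k = k.+1 by swcase.
have : k.+1 <= act q k.+1 by rewrite act_ge_notin.
by move: (act q k.+1) => z; swcase.
Qed.

Lemma pred_mem_left k x y : 0 < k.-1 -> uniq x -> k \notin x -> k \notin y ->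
  (k.-1 \in x) = (act (x ++ k :: y) k.-1 < k).
Proof.
move=> k0 ux kx ky; rewrite act_cat /= act_lt_notin //.
have ek : k.-1.+1 = k by move: k0; clear; lia.
case: (boolP (k.-1 \in x)) => [h|h]; last by rewrite act_fix ?ek //; swcase.
case/path.splitPr: h ux kx => p q; rewrite cat_uniq /= mem_cat inE !negb_or.
move=> /and3P[_ /andP[sp _] /andP[sq _]] /and3P[kp _ kq].
rewrite act_cat /= (act_fix sp) ?ek //.
have -> : sw k.-1 k.-1 = k.-2 by swcase.
have : act q k.-2 < k.-1 by rewrite act_lt_notin //; move: k0; clear; lia.
by move: (act q k.-2) => z; swcase.
Qed.

Lemma left_letters k x y x1 x2 y1 y2 : 0 < k -> 0 \notin x -> k \notin x -> k \notin y ->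
  (forall i, i \in x -> i \in y -> i = k.-1 \/ i = k.+1) -> uniq x ->
  subseq x1 x -> subseq x2 x -> subseq y1 y -> subseq y2 y ->
  act (x1 ++ k :: y1) =1 act (x2 ++ k :: y2) -> {subset x1 <= x2}.
Proof.
move=> k0 x0 kx ky h ux s1 s2 t1 t2 e i i1.
have ix := mem_subseq s1 i1.
have [u1 u2] : uniq x1 /\ uniq x2 by split; [exact: subseq_uniq s1 ux | exact: subseq_uniq s2 ux].
have [k1 k2] : k \notin x1 /\ k \notin x2.
  by split; [apply: contra kx; apply: mem_subseq s1 _ | apply: contra kx; apply: mem_subseq s2 _].
have [k3 k4] : k \notin y1 /\ k \notin y2.
  by split; [apply: contra ky; apply: mem_subseq t1 _ | apply: contra ky; apply: mem_subseq t2 _].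
have i0 : 0 < i by rewrite lt0n; apply: contraNneq x0 => <-.
have ik : i != k by apply: contraNneq kx => <-.
case: (boolP (i \in y)) => [iy|iy]; last first.
  have iy1 : i \notin y1 by apply: contra iy; apply: mem_subseq t1 _.
  have iy2 : i \notin y2 by apply: contra iy; apply: mem_subseq t2 _.
  case/path.splitPr: i1 u1 e => p q; rewrite cat_uniq /= negb_or.
  move=> /and3P[_ /andP[ip _] /andP[iq _]] e.
  have := @mem_once i p (q ++ k :: y1) (x2 ++ k :: y2) i0 ip.
  rewrite !(mem_cat, inE) (negbTE iq) (negbTE ik) (negbTE iy1) (negbTE iy2) !orbF; apply=> // z.
  by rewrite -e -catA.
case: (h i ix iy) => ei; subst i; move: i1.
  by rewrite (@pred_mem_left _ x1 y1) // (@pred_mem_left _ x2 y2) // e.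
by rewrite (@succ_mem_left _ x1 y1) // (@succ_mem_left _ x2 y2) // e.
Qed.

Section ConditionA.

Variables (n k : nat) (x y : seq nat).
Hypotheses (rt : red (x ++ [:: k] ++ y)) (wt : is_word n (x ++ [:: k] ++ y)).
Hypotheses (ux : uniq x) (uy : uniq y) (kx : k \notin x) (ky : k \notin y).
Hypothesis (hxy : forall i, i \in x -> i \in y -> i = k.-1 \/ i = k.+1).

Let k_gt0 : 0 < k. Proof. by apply: (red_gt0 rt); rewrite !(mem_cat, inE) eqxx orbT. Qed.

Let x0 : 0 \notin x.
Proof. by apply/negP => h; have := red_gt0 rt (_ : 0 \in _); rewrite mem_cat h => /(_ isT). Qed.

Let y0 : 0 \notin y.
Proof. by apply/negP => h; have := red_gt0 rt (_ : 0 \in _); rewrite !mem_cat h !orbT => /(_ isT). Qed.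

Let midA (C : {set void}) := [:: k].
Let GA (C : {set void}) := true.

Let midA_inj (A B : {set factors x y void}) : act (factored midA A) =1 act (factored midA B) -> A = B.
Proof.
rewrite /factored /midA => e.
have sl (C : {set factors x y void}) : subseq (pickl C) x by apply: filter_subseq.
have sr (C : {set factors x y void}) : subseq (pickr C) y by apply: filter_subseq.
apply: pick_eq.
- apply: uniq_subseq_eq ux (sl A) (sl B) _.
  have L (C D : {set factors x y void}) : act (pickl C ++ [:: k] ++ pickr C) =1 act (pickl D ++ [:: k] ++ pickr D) ->
      {subset pickl C <= pickl D}.
    by move=> eCD; apply: (@left_letters k x y) eCD.
  by move=> i; apply/idP/idP; [apply: L | apply: L => z].
- by apply/setP => -[].
- apply: uniq_subseq_eq uy (sr A) (sr B) _.
  have L (C D : {set factors x y void}) : act (pickl C ++ [:: k] ++ pickr C) =1 act (pickl D ++ [:: k] ++ pickr D) ->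
      {subset pickr C <= pickr D}.
    move=> /eq_act_rev; rewrite !rev_cat -!catA /= => eCD i.
    rewrite -mem_rev -[i \in pickr D]mem_rev.
    apply: (@left_letters k (rev y) (rev x)) eCD _; rewrite ?mem_rev ?rev_uniq ?subseq_rev // => j.
    by rewrite !mem_rev => jy jx; apply: hxy.
  by move=> i; apply/idP/idP; [apply: L | apply: L => z].
Qed.

Lemma conditionA_interval :
  let I := bruhat_interval (sigma n k) (word_prod n (x ++ [:: k] ++ y)) in
  is_lattice I (@bruhat n) /\ is_boolean I (@bruhat n).
Proof.
have ms (D : {set void}) s : GA D -> subseq s (midA D) -> red s -> k \in s ->
  exists C, [/\ GA C, C \subset D & s = midA C].
  move=> _ ss _ ks; exists D; split=> //; apply: subseq_size_eq ss _.
  by case: s ks.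
have mk (D : {set void}) : GA D -> exists2 p, p < k & k <= act (midA D) p.
  by exists k.-1; rewrite ?ltn_predL //= /sw eqxx.
split.
  by apply: (@factored_lattice k x y _ GA midA) => // A B _ _; apply: midA_inj.
by apply: (@factored_boolean k x y _ GA midA) => // A B _ _; apply: midA_inj.
Qed.

End ConditionA.

(* The interval [2, 2132] of S_4 is the face lattice of a square: its atoms 12, 32,
   21, 23 (in the order of the boolean arguments) are the vertices, and exactly the
   pairs {12, 23} and {32, 21} are diagonals, contained in no proper face. *)
Definition face (b0 b1 b2 b3 : bool) : bool := (b0 && b3) == (b1 && b2).

Definition square := [:: 2; 1; 3; 2].

Definition face_word (b0 b1 b2 b3 : bool) : seq nat :=
  mask [:: b2 || b3 || ~~ (b0 || b1); b0 || b2; b1 || b3; b0 || b1] square.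

Lemma face_word_mono a0 a1 a2 a3 b0 b1 b2 b3 :
  a0 ==> b0 -> a1 ==> b1 -> a2 ==> b2 -> a3 ==> b3 -> face a0 a1 a2 a3 -> face b0 b1 b2 b3 ->
  subseq (face_word a0 a1 a2 a3) (face_word b0 b1 b2 b3).
Proof. by case: a0; case: a1; case: a2; case: a3; case: b0; case: b1; case: b2; case: b3. Qed.

Lemma face_word_sub s b0 b1 b2 b3 : face b0 b1 b2 b3 ->
  subseq s (face_word b0 b1 b2 b3) -> red s -> 2 \in s ->
  exists a0 a1 a2 a3, [/\ [&& a0 ==> b0, a1 ==> b1, a2 ==> b2 & a3 ==> b3],
    face a0 a1 a2 a3 & s = face_word a0 a1 a2 a3].
Proof.
move=> f ss rs s2; exists (subseq [:: 1; 2] s), (subseq [:: 3; 2] s), (subseq [:: 2; 1] s), (subseq [:: 2; 3] s).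
have /subseqP[m] := subseq_trans ss (mask_subseq _ _).
case: m => [|m0 [|m1 [|m2 [|m3 [|? ?]]]]] //= _ es; move: f ss rs s2; rewrite es.
by case: m0 es; case: m1; case: m2; case: m3; case: b0; case: b1; case: b2; case: b3.
Qed.

Lemma face_word_differ a0 a1 a2 a3 b0 b1 b2 b3 : face a0 a1 a2 a3 -> face b0 b1 b2 b3 ->
  ~~ differ (face_word a0 a1 a2 a3) (face_word b0 b1 b2 b3) ->
  [/\ a0 = b0, a1 = b1, a2 = b2 & a3 = b3].
Proof. by case: a0; case: a1; case: a2; case: a3; case: b0; case: b1; case: b2; case: b3. Qed.

Lemma face_word_red b0 b1 b2 b3 : face b0 b1 b2 b3 -> red (face_word b0 b1 b2 b3).
Proof. by case: b0; case: b1; case: b2; case: b3. Qed.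

Lemma face_word_cross b0 b1 b2 b3 : face b0 b1 b2 b3 ->
  has (fun p => 2 <= act (face_word b0 b1 b2 b3) p) [:: 0; 1].
Proof. by case: b0; case: b1; case: b2; case: b3. Qed.

Lemma face_and a0 a1 a2 a3 b0 b1 b2 b3 : face a0 a1 a2 a3 -> face b0 b1 b2 b3 ->
  face (a0 && b0) (a1 && b1) (a2 && b2) (a3 && b3).
Proof. by case: a0; case: a1; case: a2; case: a3; case: b0; case: b1; case: b2; case: b3. Qed.

Lemma subseq_map_inv (T T' : eqType) (f : T -> T') s t : subseq s (map f t) ->
  exists2 u, subseq u t & s = map f u.
Proof. by case/subseqP=> m _ ->; exists (mask m t); rewrite ?mask_subseq ?map_mask. Qed.

Lemma red_unshift o s : red (map (addn o) s) -> 0 \notin s -> red s.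
Proof.
elim: s => //= a s IH /andP[h rs]; rewrite inE negb_or => /andP[a0 s0].
rewrite IH // andbT; have e : (o + a).-1 = o + a.-1 by move: a0; clear; lia.
by move: h; rewrite e !act_shift // ltn_add2l.
Qed.

Section ConditionB.

Variables (n o : nat) (x y : seq nat).
Let k := o + 2.
Let c := map (addn o) square.
Hypotheses (rt : red (x ++ c ++ y)) (wt : is_word n (x ++ c ++ y)).
Hypotheses (ux : uniq x) (uy : uniq y).
Hypothesis (dxy : forall i, i \in x -> i \notin y).
Hypothesis (cxy : forall i, i \in c -> i \notin x /\ i \notin y).

Let V : finType := (bool * bool)%type.
(* (letter, side) encodes an atom: (false, false) is 12, (true, false) is 32, etc. *)
Let faceB (C : {set V}) : bool :=
  face ((false, false) \in C) ((true, false) \in C) ((false, true) \in C) ((true, true) \in C).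
Let mid0 (C : {set V}) : seq nat :=
  face_word ((false, false) \in C) ((true, false) \in C) ((false, true) \in C) ((true, true) \in C).
Let midB (C : {set V}) : seq nat := map (addn o) (mid0 C).

Let kc : k \in c. Proof. by rewrite mem_map ?inE //; apply: addnI. Qed.
Let kx : k \notin x. Proof. by case: (cxy kc). Qed.
Let ky : k \notin y. Proof. by case: (cxy kc). Qed.
Let k_gt0 : 0 < k. Proof. by rewrite /k addn2. Qed.

Let midB_sub C : subseq (midB C) c.
Proof. by apply/map_subseq/mask_subseq. Qed.

Let letters_subset (A B : {set factors x y V}) : 
  act (factored midB A) =1 act (factored midB B) ->
  {subset pickl A <= pickl B} /\ {subset pickr A <= pickr B}.
Proof.
have sl (C : {set factors x y V}) : subseq (pickl C) x by apply: filter_subseq.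
have sr (C : {set factors x y V}) : subseq (pickr C) y by apply: filter_subseq.
have notc i C : i \in x \/ i \in y -> i \notin midB C.
  by move=> h; apply/negP => /(mem_subseq (midB_sub C))/cxy[]; case: h => ->.
have gt0 i : i \in x \/ i \in y -> 0 < i.
  by move=> h; apply: (red_gt0 rt); rewrite !mem_cat; case: h => ->; rewrite ?orbT.
rewrite /factored => e; split=> i iA.
  have ix := mem_subseq (sl A) iA; have iy := dxy ix.
  have iy1 C : i \notin @pickr x y V C by apply: contra iy; apply: mem_subseq (sr _) _.
  have nc C : i \notin midB C by apply: notc; left.
  have uA := subseq_uniq (sl A) ux.
  move: iA uA e; case/path.splitPr=> p q; rewrite cat_uniq /= negb_or.
  move=> /and3P[_ /andP[ip _] /andP[iq _]] e.
  have := @mem_once i p (q ++ midB (pickm A) ++ pickr A) (pickl B ++ midB (pickm B) ++ pickr B).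
  rewrite !mem_cat !(negbTE (nc _)) !(negbTE (iy1 _)) !orbF; apply=> //; first by apply: gt0; left.
  by move=> z; rewrite -e -catA.
have iy := mem_subseq (sr A) iA; have ix : i \notin x by apply: contraTN iy => /dxy.
have ix1 C : i \notin @pickl x y V C by apply: contra ix; apply: mem_subseq (sl _) _.
have nc C : i \notin midB C by apply: notc; right.
have uA := subseq_uniq (sr A) uy.
move: iA uA e; case/path.splitPr=> p q; rewrite cat_uniq /= negb_or.
move=> /and3P[_ /andP[ip _] /andP[iq _]] e.
have := @mem_once i (pickl A ++ midB (pickm A) ++ p) q (pickl B ++ midB (pickm B) ++ pickr B).
rewrite !mem_cat !(negbTE (nc _)) !(negbTE (ix1 _)) !orFb; apply=> //; first by apply: gt0; right.
by move=> z; rewrite -e -!catA.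
Qed.

Let factoredB_inj (A B : {set factors x y V}) : faceB (pickm A) -> faceB (pickm B) ->
  act (factored midB A) =1 act (factored midB B) -> A = B.
Proof.
move=> fA fB e.
have [lAB rAB] := letters_subset e; have [lBA rBA] := letters_subset (fun z => esym (e z)).
have el : pickl A = pickl B.
  apply: uniq_subseq_eq ux (filter_subseq _ _) (filter_subseq _ _) _ => i.
  by apply/idP/idP; [apply: lAB | apply: lBA].
have er : pickr A = pickr B.
  apply: uniq_subseq_eq uy (filter_subseq _ _) (filter_subseq _ _) _ => i.
  by apply/idP/idP; [apply: rAB | apply: rBA].
apply: (pick_eq el _ er).
have em : act (midB (pickm A)) =1 act (midB (pickm B)).
  apply: (@eq_act_catIr (pickr B)); apply: (@eq_act_catI (pickl B)).
  by move: e; rewrite /factored el er.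
case: (boolP (differ (mid0 (pickm A)) (mid0 (pickm B)))) => [h|].
  by case: (differ_shift (face_word_red fA) (face_word_red fB) h em).
case/(face_word_differ fA fB) => e0 e1 e2 e3.
by apply/setP => -[[] []].
Qed.

Lemma conditionB_lattice :
  is_lattice (bruhat_interval (sigma n k) (word_prod n (x ++ c ++ y))) (@bruhat n).
Proof.
have eT : midB [set: V] = c by rewrite /midB /mid0 !inE.
rewrite -eT; apply: (@factored_lattice k x y V faceB midB) => //.
- move=> C D fC fD /subsetP CD; apply: map_subseq.
  by apply: face_word_mono => //; apply/implyP; apply: CD.
- move=> D s fD /subseq_map_inv[u uD ->] ru ku.
  have u0 : 0 \notin u by apply: contra (red_notin0 (face_word_red fD)); apply: mem_subseq.
  have u2 : 2 \in u by rewrite -(mem_map (@addnI o)).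
  have [a0 [a1 [a2 [a3 [/and4P[h0 h1 h2 h3] fa eu]]]]] := face_word_sub fD uD (red_unshift ru u0) u2.
  pose C : {set V} := [set v | match v with (false, false) => a0 | (true, false) => a1
                                  | (false, true) => a2 | (true, true) => a3 end].
  exists C; split; rewrite /faceB /midB /mid0 ?inE ?eu //.
  by apply/subsetP => -[[] []]; rewrite inE; apply/implyP.
- move=> D fD; have /hasP[p p01 h] := face_word_cross fD.
  exists (o + p); first by rewrite ltn_add2l; move: p01; rewrite !inE => /orP[]/eqP->.
  by rewrite act_shift ?leq_add2l // red_notin0 // face_word_red.
- by rewrite /faceB !inE.
- by rewrite eT.
- by move=> C D fC fD; rewrite /faceB !inE; apply: face_and.
Qed.

End ConditionB.

Theorem theorem5p5 (n k : nat) (hk : 1 <= k <= n - 1) (w : 'S_n)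
  (hw : bruhat (sigma n k) w) :
  (is_lattice (bruhat_interval (sigma n k) w) (@bruhat n) <->
     conditionA k w \/ conditionB k w) /\
  (conditionA k w -> is_boolean (bruhat_interval (sigma n k) w) (@bruhat n)).
Proof.
have k0 : 0 < k by case/andP: hk.
have A_int : conditionA k w -> is_lattice (bruhat_interval (sigma n k) w) (@bruhat n) /\
    is_boolean (bruhat_interval (sigma n k) w) (@bruhat n).
  case=> x [y [/reduced_decompositionP[wt <- rt] [ux uy] hxy [kx ky]]].
  exact: conditionA_interval.
split; last by case/A_int.
split; last first.
  case=> [/A_int[]//|[x [y [/reduced_decompositionP[wt <- rt] [ux uy] dxy cxy]]]].
  have k1 : 0 < k.-1 by apply: (red_gt0 rt); rewrite !(mem_cat, inE) eqxx !orbT.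
  have ek : k = k - 2 + 2 by move: k1; clear; lia.
  have ec : [:: k; k.-1; k.+1; k] = map (addn (k - 2)) square.
    have -> : k.-1 = k - 2 + 1 by move: k1; clear; lia.
    have -> : k.+1 = k - 2 + 3 by move: k1; clear; lia.
    by rewrite /= -ek.
  rewrite ec in rt wt *; rewrite [in sigma n k]ek; apply: conditionB_lattice => // i.
  by rewrite -ec => ic; apply: cxy; move: ic; rewrite !inE => /or4P[]->; rewrite ?orbT.
case: hw => s [t [/reduced_decompositionP[ws es rs] /reduced_decompositionP[wt <- rt] st]].
move=> lat.
have wk : is_word n [:: k] by rewrite /is_word /= k0 andbT; move: hk; clear; lia.
have kt : k \in t.
  apply: (mem_subseq st); apply: sub1_mem => //.
  by exists s => //; apply/(word_prod_eq ws wk); rewrite es word_prod1.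
have red_form u : act u =1 act t -> size u = size t -> reduced_decomposition (word_prod n t) u.
  move=> e sz; have ru : red u by apply: red_shortest rt (fun p => esym (e p)) _; rewrite sz.
  have wu : is_word n u by apply: is_word_sub wt => i; apply: red_mem ru rt e.
  by apply/reduced_decompositionP; split=> //; apply/word_prod_eq.
case: (crossing_free_form rt kt (lattice_crossing_free wt rt kt lat)) => [] [x [y [e sz [u h1 h2]]]];
  [left|right]; exists x, y; split=> //; exact: red_form.
Qed.
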